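(* Let $\Omega$ be a bounded open domain of $\mathbb{R}^n$ with outward unit normal $\nu$ on $\partial\Omega$, let $p\ge1$, $0<\vartheta\le\varTheta$, and let $u\in\mathscr{M}^-(\vartheta,\varTheta,\lambda|u|^p)\cap C^1(\overline{\Omega})$ be a viscosity supersolution of the Dirichlet eigenvalue problem $$\mathcal{M}^-(\nabla^2u,\vartheta,\varTheta)=\lambda|u|^p\ \text{ in }\Omega,\qquad u=0\ \text{ on }\partial\Omega.$$ Assume that $\inf_{\partial\Omega}\left|\frac{\partial u}{\partial\nu}\right|>0$. Then $$\lambda\ge\frac{\inf_{\partial\Omega}\left|\frac{\partial u}{\partial\nu}\right|}{C\,\|u^p\|_{L^n(\Omega\cap\Gamma_u)}},$$ where $C$ is a constant depending only on $n,\vartheta,\varTheta$.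
   Context: For a real symmetric $n\times n$ matrix $A$ with eigenvalues $e_i$, the Pucci extremal operator is $\mathcal{M}^-(A,\vartheta,\varTheta)=\vartheta\sum_{e_i>0}e_i+\varTheta\sum_{e_i<0}e_i$. For continuous $g$ in $\Omega$, $\mathscr{M}^-(\vartheta,\varTheta,g)$ is the space of continuous functions $u$ in $\Omega$ with $\mathcal{M}^-(\nabla^2u,\vartheta,\varTheta)\le g(x)$ in the viscosity sense (i.e. $u$ is a viscosity supersolution): whenever $x_0\in\Omega$, $\phi\in C^2(\Omega)$ and $u-\phi$ has a local minimum at $x_0$, then $\mathcal{M}^-(\nabla^2\phi(x_0),\vartheta,\varTheta)\le g(x_0)$. The boundary condition is $u=0$ on $\partial\Omega$. The lower contact set is $\Gamma_u:=\{x\in\Omega:\ u(y)\ge u(x)+\nabla u(x)\cdot(y-x)\ \ \forall y\in\overline{\Omega}\}$. $\|u^p\|_{L^n}$ means $\|\,|u|^p\,\|_{L^n}$.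
   Formalization: The formal theorem additionally assumes ∂u/∂ν ≥ 0 on ∂Ω (so |∂u/∂ν| = ∂u/∂ν, automatic when u ≤ 0); without this sign condition the stated bound fails, e.g. for supersolutions that become positive near ∂Ω with steep negative normal derivative. *)

(* Defs.v *)
From HB Require Import structures.
From mathcomp Require Import all_boot all_order all_algebra.
From mathcomp Require Import all_classical all_reals all_analysis.

Set Implicit Arguments.
Unset Strict Implicit.
Unset Printing Implicit Defensive.

Import Order.TTheory GRing.Theory Num.Theory.
Import numFieldNormedType.Exports.

Local Open Scope classical_set_scope.
Local Open Scope ring_scope.

(** R^N is ['rV[R]_N]; the library norm on it is the sup norm, which induces
    the usual topology, bounded sets and differentials. The Euclidean
    structure is given by [dotv]. *)

Section Euclidean.
Context {R : realType} {N : nat}.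
Implicit Types (x y v : 'rV[R]_N) (Om : set 'rV[R]_N) (f : 'rV[R]_N -> R).

Definition dotv x y : R := \sum_(i < N) x 0 i * y 0 i.

Definition grad f x : 'rV[R]_N := \row_i 'D_(delta_mx 0 i) f x.

Definition hess f x : 'M[R]_N :=
  \matrix_(i, j) 'D_(delta_mx 0 i) (fun y => grad f y 0 j) x.

Definition bdry Om : set 'rV[R]_N := closure Om `\` Om°.

Definition bounded_domain Om : Prop :=
  [/\ open Om, connected Om, Om !=set0 & bounded_set Om].

(** [v] is the outward unit normal of [Om] at the boundary point [x]: near [x],
    up to an error o(|y - x|), [Om] is the half-space (y - x) . v < 0. Such a
    [v] is unique, and for a C^1 domain it is the classical outward normal.
    As eps is arbitrary, the choice of the norm |y - x| is immaterial. *)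
Definition outward_unit_normal Om x v : Prop :=
  dotv v v = 1 /\
  forall eps : R, 0 < eps -> \forall y \near x,
    (dotv (y - x) v < - eps * `|y - x| -> Om y) /\
    (eps * `|y - x| < dotv (y - x) v -> ~ Om y).

(** [u] is C^1 up to the boundary, and [Du] is the continuous extension of its
    gradient to the closure of [Om] (where it is uniquely determined). *)
Definition C1_closure Om (u : 'rV[R]_N -> R) (Du : 'rV[R]_N -> 'rV[R]_N) :=
  [/\ {within closure Om, continuous u},
      {within closure Om, continuous Du} &
      forall x, Om x -> differentiable u x /\ grad u x = Du x].

Definition C2_on Om (phi : 'rV[R]_N -> R) : Prop :=
  forall x, Om x ->
    [/\ differentiable phi x,
        forall j, differentiable (fun y => grad phi y 0 j) x &
        forall i j, {for x, continuous (fun y => hess phi y i j)}].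

(** The eigenvalues of [A] listed with multiplicity. The list exists whenever
    [A] is symmetric, and it is unique up to the order. *)
Definition eigenvalues (A : 'M[R]_N) : seq R :=
  xget [::] [set s | char_poly A = \prod_(e <- s) ('X - e%:P)].

Definition pucci_minus (A : 'M[R]_N) (vt vT : R) : R :=
  vt * (\sum_(e <- eigenvalues A | 0 < e) e) +
  vT * (\sum_(e <- eigenvalues A | e < 0) e).

Definition Mminus_class Om (vt vT : R) (g u : 'rV[R]_N -> R) : Prop :=
  (forall x, Om x -> {for x, continuous u}) /\
  (forall x0 (phi : 'rV[R]_N -> R), Om x0 -> C2_on Om phi ->
     (\forall y \near x0, u x0 - phi x0 <= u y - phi y) ->
     pucci_minus (hess phi x0) vt vT <= g x0).

Definition lower_contact Om (u : 'rV[R]_N -> R) : set 'rV[R]_N :=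
  [set x | Om x /\
    forall y, closure Om y -> u x + dotv (grad u x) (y - x) <= u y].

End Euclidean.

(** Lebesgue measure on R^(n+1): the restriction of the Lebesgue outer measure
    to its Caratheodory measurable sets. The dimension is kept positive as for
    dimension 0 the covers below are not the right ones. *)
Section Lebesgue.
Context {R : realType} {n : nat}.
Local Notation V := 'rV[R]_n.+1.

Definition open_box (ab : V * V) : set V :=
  [set x | forall i, ab.1 0 i < x 0 i < ab.2 0 i].

Definition box_volume (ab : V * V) : R :=
  \prod_(i < n.+1) Num.max 0 (ab.2 0 i - ab.1 0 i).

Definition box_cover (A : set V) : set (nat -> V * V) :=
  [set F | A `<=` \bigcup_k open_box (F k)].

Local Open Scope ereal_scope.

Definition lebesgue_outer (A : set V) : \bar R :=
  ereal_inf [set \sum_(k <oo) (box_volume (F k))%:E | F in box_cover A].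

Let vol_ge0 ab : 0 <= (box_volume ab)%:E.
Proof. by rewrite lee_fin; apply: prodr_ge0 => i _; rewrite le_max lexx. Qed.

Let outer_ge0 A : 0 <= lebesgue_outer A.
Proof. by apply: le_ereal_inf_tmp => _ [F _ <-]; exact: nneseries_ge0. Qed.

Let outer0 : lebesgue_outer set0 = 0.
Proof.
apply/eqP; rewrite eq_le outer_ge0 andbT; apply: ereal_inf_lbound.
exists (fun=> (0%R, 0%R)); first by move=> x.
apply: lim_near_cst => //; near=> m; rewrite big1// => i _.
by rewrite /box_volume big_ord_recl/= subrr maxxx mul0r.
Unshelve. all: by end_near. Qed.

Let le_outer : {homo lebesgue_outer : A B / A `<=` B >-> A <= B}.
Proof.
move=> A B AB; apply/ereal_inf_le_tmp => _ [F BF <-].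
by exists F => //; exact: subset_trans BF.
Qed.

Let outer_sigma_subadditive : sigma_subadditive lebesgue_outer.
Proof.
move=> A; have [[i ioo]|] := pselect (exists i, lebesgue_outer (A i) = +oo).
  by rewrite (eseries_pinfty _ _ ioo) ?leey// => k _;
     rewrite -ltNye (lt_le_trans _ (outer_ge0 _)).
rewrite -forallNE => Aoo.
apply/lee_addgt0Pr => _/posnumP[e].
rewrite (le_trans _ (epsilon_trick _ _ _))//.
pose P k (B : nat -> V * V) := box_cover (A k) B /\
  \sum_(j <oo) (box_volume (B j))%:E
    <= lebesgue_outer (A k) + (e%:num / (2 ^ k.+1)%:R)%:E.
have [G PG] : {G : nat -> nat -> V * V & forall k, P k (G k)}.
  apply: (@choice _ _ P) => k; rewrite /P.
  have en1 : (0 < e%:num / (2 ^ k.+1)%:R)%R by [].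
  have /(lb_ereal_inf_adherent en1) : lebesgue_outer (A k) \is a fin_num.
    by rewrite ge0_fin_numE// ltey; apply/eqP/Aoo.
  by move=> [_ [B AB <-] /ltW AkB]; exists B.
pose vol (ij : nat * nat) := (box_volume (G ij.1 ij.2))%:E.
have vol0 ij : 0 <= vol ij by exact: vol_ge0.
apply: (@le_trans _ _ (\esum_(i in setT) vol i)).
  apply: ereal_inf_lbound => /=.
  have /card_esym/ppcard_eqP[f] := card_nat2.
  exists (fun k => G (f k).1 (f k).2).
    move=> t [i _ Ait]; have [j _ Gt] := (PG i).1 _ Ait.
    by exists (f^-1%FUN (i, j)) => //=; rewrite invK ?inE.
  transitivity (\sum_(k <oo) (vol \o f) k) => //.
  rewrite -(esum_pred_image vol f xpredT) ?[fun=> _]set_true//.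
  by rewrite image_eq.
rewrite (_ : esum _ _ = \sum_(i <oo) \sum_(j <oo) vol (i, j)); last first.
  pose J : nat -> set (nat * nat) := fun i => [set (i, j) | j in setT].
  rewrite (_ : setT = \bigcup_k J k); last first.
    by rewrite predeqE => -[a b]; split => // _; exists a => //; exists b.
  rewrite esum_bigcupT//=; last first.
    apply/trivIsetP => i j _ _ ij.
    rewrite predeqE => -[a m] /=; split => //= -[] [_] _ [<-{a} _].
    by move=> [m' _] [] /esym/eqP; rewrite (negbTE ij).
  rewrite -(image_id [set: nat]) -fun_true esum_pred_image//; last first.
    by move=> k _; exact: esum_ge0.
  apply: eq_eseriesr => /= j _.
  rewrite -(esum_pred_image vol (pair j) predT)//=; last first.
    by move=> ? ? _ _; exact: (@can_inj _ _ _ snd).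
  by congr esum; rewrite predeqE => -[a b]; split; move=> [i _ <-]; exists i.
apply: lee_nneseries => [i _ _|i _]; last exact: (PG i).2.
exact: nneseries_ge0.
Qed.

HB.instance Definition _ := isOuterMeasure.Build R V lebesgue_outer
  outer0 outer_ge0 le_outer outer_sigma_subadditive.

Let U := caratheodory_type (lebesgue_outer : {outer_measure set V -> \bar R}).

Definition lebesgue_rV : set U -> \bar R := lebesgue_outer.

Let rV0 : lebesgue_rV set0 = 0.
Proof. exact: outer0. Qed.

Let rV_ge0 (A : set U) : 0 <= lebesgue_rV A.
Proof. exact: outer_ge0. Qed.

Let rV_sigma_additive : semi_sigma_additive lebesgue_rV.
Proof. exact: caratheodory_measure_sigma_additive. Qed.

HB.instance Definition _ := isMeasure.Build _ _ _ lebesgue_rV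
  rV0 rV_ge0 rV_sigma_additive.

(** The L^q(A) norm, through the extension of [f] by 0 outside [A]. *)
Definition Lnorm_on (q : R) (A : set V) (f : V -> R) : \bar R :=
  'N[lebesgue_rV]_(q%:E)[EFin \o (f \_ A)%R].

End Lebesgue.

(* Main.v *)
Require Import Defs.
From HB Require Import structures.
From mathcomp Require Import all_boot all_order all_algebra.
From mathcomp Require Import all_classical all_reals all_analysis.
From mathcomp Require Import measurable_realfun.
From mathcomp Require Import ring lra.

Set Implicit Arguments.
Unset Strict Implicit.
Unset Printing Implicit Defensive.

Import Order.TTheory GRing.Theory Num.Theory.
Import numFieldNormedType.Exports.

Local Open Scope classical_set_scope.
Local Open Scope ring_scope.

(** Let [m] be the infimum of the normal derivative. If every coordinate of [xi]
    is at most [m / (2N)] in absolute value, then [y |-> u y - xi . y] attains its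
    minimum over the closure of [Om] inside [Om], because it decreases strictly
    when one enters [Om] from the boundary: the gradient of [u] maps the contact
    set onto a cube of side [m / N]. Conversely, at two contact points at distance
    [r] the slopes differ by at most a constant times [r lam |u|^p]: otherwise a
    quadratic barrier would touch [u] from below and violate the supersolution
    property. So the gradient is locally Lipschitz on the contact set, and it
    expands the outer measure at most by a constant times [(lam |u|^p)^N].
    Integrating, the volume of the cube is at most a constant times
    [lam^N] times the integral of [|u|^(p N)] over the contact set. *)

(** * Volume of a cube *)

(** For smooth [u] one would bound the Jacobian of the gradient map by the arithmetic-geometric mean
    inequality and use the area formula. Here [u] is only C^1 and the inequality holds in the
    viscosity sense, so there is no Hessian to take a determinant of. Testing with an explicit
    quadratic polynomial at a contact point controls differences of gradients instead, and a local
    Lipschitz bound already limits the outer measure of an image, at the price of a dimensional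
    constant. That Lipschitz bound depends on the size of [lam |u|^p] near the point, so it is
    frozen on countably many small pieces and an error [eps] is carried until the end. The sign of
    [lam] is not given either: the estimates are made with any [lam'] above both [lam] and 0, and
    [lam' = 0] then excludes [lam <= 0]. The constant [vT] shapes the barrier, hence the scale on
    which the Lipschitz bound holds; the bound itself involves only N and [vt], and C comes out as
    512 N^2 / vt. *)

Section Counting.
Context {R : realType}.

Lemma card_ord_between (M : nat) (a b : R) :
  #|[set j : 'I_M | (a < j%:R < b)%R]%SET|%:R <= Num.max 0 (b - a) + 1.
Proof.
set S := [set _ | _]%SET.
have [->|[j jS]] := set_0Vmem S.
  by rewrite cards0 addr_ge0// le_max lexx.
pose i := [arg min_(i < j in S) i].
have [iS imin] : i \in S /\ forall k, k \in S -> (i <= k)%N.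
  by rewrite /i; case: arg_minnP.
pose d := (Num.truncn (b - a)).+1.
have iSab : a < i%:R < b by move: iS; rewrite inE.
have ba0 : 0 <= b - a by rewrite subr_ge0; lra.
have lt_d k : k \in S -> (k - i < d)%N.
  move=> kS; have := imin _ kS => ik.
  rewrite ltnS truncn_ge_nat// natrB//.
  by move: kS; rewrite inE => /andP[_ kb]; lra.
have : (#|S| <= d)%N.
  rewrite -[leqRHS]card_ord.
  apply: (leq_card_in (fun k : 'I_M => inord (k - i) : 'I_d)).
  move=> k l kS lS /(congr1 val) /=; rewrite !inordK ?lt_d//.
  by move=> e; apply/val_inj; rewrite /= -(subnK (imin _ kS)) e subnK// imin.
rewrite -(ler_nat R) => /le_trans; apply.
rewrite /d -addn1 natrD lerD2r le_max; apply/orP; right.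
by rewrite truncn_le.
Qed.

Lemma card_ffun_all (I : finType) (M : nat) (P : I -> pred 'I_M) :
  #|[set f : {ffun I -> 'I_M} | [forall i, P i (f i)]]%SET| =
  (\prod_i #|[set j | P i j]%SET|)%N.
Proof.
transitivity #|family (fun i => [pred j | P i j])|.
  apply: eq_card => f; rewrite inE.
  by apply/forallP/familyP => h i; have := h i.
rewrite card_family foldrE big_map big_enum/=.
by apply: eq_bigr => i _; apply: eq_card => j; rewrite !inE.
Qed.

End Counting.

Section Volume.
Context {R : realType} {n : nat}.
Local Notation V := 'rV[R]_n.+1.

Definition side (ab : V * V) (i : 'I_n.+1) : R :=
  Num.max 0 (ab.2 0 i - ab.1 0 i).

Lemma side_ge0 ab i : 0 <= side ab i.
Proof. by rewrite /side le_max lexx. Qed.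

Definition cube (h : R) : set V := [set x | forall i, - h <= x 0 i <= h].

Lemma open_box_open (ab : V * V) : open (open_box ab).
Proof.
rewrite openE => x abx.
have ab_near i : \forall y \near x, ab.1 0 i < (y : V) 0 i < ab.2 0 i.
  have /andP[ax xb] := abx i.
  have cx : {for x, continuous (fun y : V => y 0 i)} by exact: coord_continuous.
  near=> y; apply/andP; split; near: y.
    by apply: (cvgr_gt _ cx).
  by apply: (cvgr_lt _ cx).
exact: filter_forall ab_near.
Unshelve. all: by end_near. Qed.

(* Count the points of a lattice of mesh [2h/M] in both sides of the inclusion
   and let [M] grow. *)
Lemma cube_volume_le_fin_cover (h : R) (s : seq nat) (F : nat -> V * V) :
  0 < h -> cube h `<=` \bigcup_(k in [set` s]) open_box (F k) ->
  (2 * h) ^+ n.+1 <= \sum_(k <- s) box_volume (F k).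
Proof.
move=> h0 hs.
pose c k i := side (F k) i / (2 * h).
have c0 k i : 0 <= c k i by rewrite /c divr_ge0 ?side_ge0//; lra.
(* An open interval holds at most [c M + 1] of M equidistant points if [c] is its length relative to
   the cube. So [q] at 1/M bounds the fraction of lattice points caught by the boxes. Being a
   polynomial, it is continuous at 0, where its value is the total volume of the boxes relative to
   that of the cube. *)
pose q : {poly R} := \sum_(k <- s) \prod_i ((c k i)%:P + 'X).
have qE x : q.[x] = \sum_(k <- s) \prod_i (c k i + x).
  rewrite /q horner_sum; apply: eq_bigr => k _.
  rewrite horner_prod; apply: eq_bigr => i _.
  by rewrite hornerD hornerX hornerC.
have q1 (M : nat) : 1 <= q.[M.+1%:R^-1].
  rewrite qE.
  pose p (f : {ffun 'I_n.+1 -> 'I_M.+1}) : V :=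
    \row_i (- h + 2 * h * (f i)%:R / M.+1%:R).
  have M0 : 0 < M.+1%:R :> R by [].
  have pcube f : cube h (p f).
    move=> i; rewrite mxE.
    have /andP[f0 f1] : (0 <= ((f i)%:R : R) / M.+1%:R <= 1)%R.
      rewrite divr_ge0//= ler_pdivrMr// mul1r ler_nat.
      by rewrite ltnW.
    rewrite -mulrA; move: (_ / _) f0 f1 => t t0 t1.
    by apply/andP; split; nra.
  pose S k := [set f : {ffun 'I_n.+1 -> 'I_M.+1} |
    [forall i, (F k).1 0 i < p f 0 i < (F k).2 0 i]]%SET.
  have cardS k : #|S k|%:R <= M.+1%:R ^+ n.+1 * \prod_i (c k i + M.+1%:R^-1).
    have -> : #|S k| = (\prod_i #|[set j : 'I_M.+1 | (((F k).1 0 i + h) / (2 * h)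
        * M.+1%:R < j%:R < ((F k).2 0 i + h) / (2 * h) * M.+1%:R)%R]%SET|)%N.
      rewrite -card_ffun_all; apply: eq_card => f; rewrite !inE.
      apply: eq_forallb => i; rewrite mxE.
      have h2 : 0 < 2 * h by rewrite mulr_gt0.
      rewrite -[_ * M.+1%:R < _]ltr_pdivlMr// -[_ < _ * M.+1%:R]ltr_pdivrMr//.
      rewrite (ltr_pdivrMr _ _ h2) (ltr_pdivlMr _ _ h2) -[2 * h * _ / _]mulrA.
      move: (_ / M.+1%:R) => t.
      by congr (_ && _); apply/idP/idP; lra.
    rewrite natr_prod -[X in _ ^+ X](card_ord n.+1) -prodr_const.
    rewrite -big_split/=; apply: ler_prod => i _; rewrite ler0n/=.
    apply: (le_trans (card_ord_between _ _ _)).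
    rewrite mulrDr mulfV ?gt_eqF// lerD2r.
    rewrite -mulrBl -mulrBl opprD addrACA subrr addr0.
    rewrite ge_max mulr_ge0//= [leRHS]mulrC ler_wpM2r// /c ler_wpM2r//.
      by rewrite invr_ge0 mulr_ge0// ltW.
    by rewrite /side le_max lexx orbT.
  have : (#|{ffun 'I_n.+1 -> 'I_M.+1}| <= \sum_(k <- s) #|S k|)%N.
    rewrite -sum1_card; under [X in (_ <= X)%N]eq_bigr do rewrite -sum1_card.
    under [X in (_ <= X)%N]eq_bigr do rewrite big_mkcond/=.
    rewrite exchange_big/=; apply: leq_sum => f _.
    have [k ks /= kf] := hs _ (pcube f).
    rewrite (big_rem k)//= inE ifT//.
    by apply/forallP.
  rewrite card_ffun !card_ord -(ler_nat R) natrX natr_sum => le1.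
  rewrite -(@ler_pM2l _ (M.+1%:R ^+ n.+1)) ?exprn_gt0// mulr1.
  by apply: (le_trans le1); rewrite mulr_sumr; apply: ler_sum => k _; exact: cardS.
have : 1 <= q.[0].
  have qcvg : q.[m.+1%:R^-1] @[m --> \oo] --> q.[0].
    apply: (@cvg_comp _ _ _ (fun m => m.+1%:R^-1) (horner q) \oo (nbhs 0)).
      exact: cvg_harmonic.
    exact: continuous_horner.
  rewrite -(cvg_lim _ qcvg)//; apply: limr_ge; first by apply/cvg_ex; exists q.[0].
  by near=> m; exact: q1.
rewrite qE => q01; rewrite -[leLHS]mulr1.
apply: (le_trans (ler_wpM2l _ q01)); first by rewrite exprn_ge0//; lra.
rewrite mulr_sumr; apply: ler_sum => k _.
rewrite -[X in _ ^+ X](card_ord n.+1) -prodr_const -big_split/=.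
rewrite le_eqVlt; apply/orP; left; apply/eqP; apply: eq_bigr => i _.
rewrite /c addr0 mulrC divfK//; lra.
Unshelve. all: by end_near. Qed.
End Volume.

(** * Outer measure of images under locally Lipschitz maps *)

Section OuterMeasure.
Context {R : realType} {n : nat}.
Local Notation V := 'rV[R]_n.+1.
Local Notation outer := (lebesgue_outer : {outer_measure set V -> \bar R}).

Lemma box_volume_ge0 (ab : V * V) : 0 <= box_volume ab.
Proof. by apply: prodr_ge0 => i _; exact: side_ge0. Qed.

Lemma lebesgue_outer_open_box (ab : V * V) :
  (outer (open_box ab) <= (box_volume ab)%:E)%E.
Proof.
apply: ereal_inf_lbound.
exists (fun k => if k == 0%N then ab else (0, 0)).
  by move=> x abx; exists 0%N.
rewrite (nneseries_split _ 1); last by move=> k _; rewrite lee_fin box_volume_ge0.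
rewrite big_mkord big_ord1 eseries0 ?adde0// => -[//|k] _ _.
by rewrite /box_volume big_ord_recl/= subrr maxxx mul0r.
Qed.

Lemma coord_norm_le (x : V) i : `|x 0 i| <= `|x|.
Proof. by rewrite [leRHS]/Num.norm/= mx_normrE (le_bigmax _ _ (0, i)). Qed.

Lemma norm_lt_coord (x : V) e : 0 < e -> (forall i, `|x 0 i| < e) -> `|x| < e.
Proof.
move=> e0 xe; rewrite [ltLHS]/Num.norm/= mx_normrE.
by apply/bigmax_ltP; split => // -[j i] _; rewrite ord1.
Qed.

Lemma cube_compact (h : R) : compact (cube h : set V).
Proof.
apply: (@rV_compact _ _ (fun=> `[- h, h]%classic)) => _.
exact: segment_compact.
Qed.

(** By Heine-Borel, a countable cover by open boxes has a finite subcover, to which the lattice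
    count applies; its indices lie below some [M], so its volume is at most a partial sum of the
    series. *)
Lemma lebesgue_outer_cube_ge (h : R) : 0 < h ->
  (((2 * h) ^+ n.+1)%:E <= outer (cube h))%E.
Proof.
move=> h0; apply: le_ereal_inf_tmp => _ [F hF <-].
have /(_ _ setT (fun k => open_box (F k))) : cover_compact (cube h : set V).
  by rewrite -compact_cover; exact: cube_compact.
case=> [k _|//|D' _ hD']; first exact: open_box_open.
pose M := (\max_(k <- finmap.enum_fset D') k).+1.
apply: (@le_trans _ _ (\sum_(0 <= k < M) (box_volume (F k))%:E)%E).
  rewrite sumEFin lee_fin; apply: cube_volume_le_fin_cover => // x /hD'[k kD' kx].
  exists k => //=; rewrite mem_index_iota/= ltnS.
  by rewrite (@leq_bigmax_seq _ _ xpredT id).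
by apply: nneseries_lim_ge => k _ _; rewrite lee_fin box_volume_ge0.
Qed.

Lemma lebesgue_outer_fin_bigcup (I : finType) (P : pred I) (F : I -> set V) :
  (outer (\big[setU/set0]_(i | P i) F i) <= \sum_(i | P i) outer (F i))%E.
Proof.
elim/big_ind2 : _ => [|A x B y Ax By|//]; first by rewrite outer_measure0.
by apply: (le_trans (outer_measureU2 _ _ _)); exact: leeD.
Qed.

(* Cut the box into at most [2^N vol / d^N] subcubes of side [d]: each is mapped
   into a cube of side [8 L d]. *)
Lemma lebesgue_outer_image_box (A : set V) (psi : V -> V) (L e : R) (ab : V * V) :
  0 < L -> 0 < e ->
  (forall x y, A x -> A y -> `|x - y| < e -> `|psi x - psi y| <= L * `|x - y|) ->
  (outer (psi @` (A `&` open_box ab)) <=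
    ((16 * L) ^+ n.+1 * box_volume ab)%:E)%E.
Proof.
move=> L0 e0 lip.
(* A box with a vanishing side is empty; it is set aside because the mesh [d] below must be
   positive. *)
have [allpos|] := pselect (forall i, 0 < side ab i); last first.
  move=> /existsNP[i /negP]; rewrite -leNgt => side0.
  rewrite (_ : _ @` _ = set0); last first.
    apply/seteqP; split => // y [x [_ abx] _].
    move: side0; rewrite /side ge_max lexx/=.
    have /andP[ax xb] := abx i; rewrite subr_le0 => ba.
    by have := lt_trans ax xb; rewrite ltNge ba.
  rewrite outer_measure0 lee_fin mulr_ge0 ?box_volume_ge0// exprn_ge0//.
  by rewrite mulr_ge0// ltW.
have sideE i : side ab i = ab.2 0 i - ab.1 0 i.
  by have := allpos i; rewrite /side /Order.max; case: ifPn => //; rewrite ltxx.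
(* The mesh is at most each side, so that rounding up at most doubles the number of subcubes per
   direction, and at most [e / 4], so that two points of one subcube are close enough for the
   Lipschitz bound. *)
pose d := \big[Num.min/(e / 4)]_i side ab i.
have d0 : 0 < d by apply/bigmin_gtP; split => //; rewrite divr_gt0.
have dside i : d <= side ab i by exact: bigmin_le_cond.
have de : d <= e / 4 by exact: bigmin_le_id.
pose m i := (Num.truncn (side ab i / d)).+1.
have mle i : (m i)%:R <= 2 * side ab i / d.
  rewrite /m -natr1 -mulrA mulr_natl mulr2n lerD//.
    by rewrite truncn_le divr_ge0 ?side_ge0// ltW.
  by rewrite ler_pdivlMr// mul1r.
(* Finite functions have a single codomain: the indices range below the largest count, and [P]
   restricts each of them to its own count [m i]. *)
pose M := (\max_i m i)%N.
pose P (f : {ffun 'I_n.+1 -> 'I_M}) := [forall i, (f i < m i)%N].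
pose Q (f : {ffun 'I_n.+1 -> 'I_M}) : set V := [set x | forall i,
  ab.1 0 i + (f i)%:R * d <= x 0 i < ab.1 0 i + (f i).+1%:R * d].
have cov : A `&` open_box ab `<=` \big[setU/set0]_(f | P f) (A `&` Q f).
  move=> x [Ax abx].
  pose t i := Num.truncn ((x 0 i - ab.1 0 i) / d).
  have xa i : 0 <= (x 0 i - ab.1 0 i) / d.
    by have /andP[ax _] := abx i; rewrite divr_ge0 ?(ltW d0)// subr_ge0 ltW.
  have tm i : (t i < m i)%N.
    rewrite /t /m ltnS le_truncn// ler_wpM2r// ?invr_ge0 ?(ltW d0)//.
    rewrite sideE lerD2r.
    by have /andP[_ xb] := abx i; exact: ltW.
  have tM i : (t i < M)%N by apply: (leq_trans (tm i)); exact: leq_bigmax.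
  pose f := [ffun i => Ordinal (tM i)].
  rewrite (bigD1 f)/=; last by apply/forallP => i; rewrite ffunE/=.
  left; split => // i; rewrite ffunE/=.
  have := truncn_itv (xa i); rewrite -/(t i) ler_pdivlMr// ltr_pdivrMr//.
  by rewrite lerBrDl ltrBlDl.
apply: (@le_trans _ _ (\sum_(f | P f) outer (psi @` (A `&` Q f)))%E).
  apply: (le_trans _ (lebesgue_outer_fin_bigcup _ _)).
  apply: le_outer_measure => _ [x /cov Ax <-].
  move: Ax; elim/big_ind2 : _ => [//|B B' C C' BB' CC' [Bx|Cx]|f Pf ABx].
  - by left; exact: BB'.
  - by right; exact: CC'.
  - by exists x.
have imQ f : (outer (psi @` (A `&` Q f)) <= ((8 * L * d) ^+ n.+1)%:E)%E.
  have [->|/set0P[x0 [Ax0 Qx0]]] := eqVneq (A `&` Q f) set0.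
    rewrite image_set0 outer_measure0 lee_fin exprn_ge0//.
    by rewrite !mulr_ge0// ltW.
  pose c : V * V := (\row_i (psi x0 0 i - 4 * L * d), \row_i (psi x0 0 i + 4 * L * d)).
  have Ld : 0 < L * d by rewrite mulr_gt0.
  apply: (@le_trans _ _ (outer (open_box c))).
    apply: le_outer_measure => _ [x [Ax Qx] <-] i; rewrite !mxE/=.
    have xx0 : `|x - x0| < 2 * d.
      apply: norm_lt_coord => [|j]; first by rewrite mulr_gt0.
      have /andP[] := Qx j; have /andP[] := Qx0 j.
      rewrite !mxE -natr1 mulrDl mul1r => ? ? ? ?.
      by rewrite ltr_norml; apply/andP; split; lra.
    have := lip _ _ Ax Ax0.
    have -> : `|x - x0| < e by lra.
    move=> /(_ isT) psix.
    have := coord_norm_le (psi x - psi x0) i; rewrite !mxE => psii.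
    have {psix psii} : `|psi x 0 i - psi x0 0 i| <= L * (2 * d).
      by apply: (le_trans psii); apply: (le_trans psix); rewrite ler_pM2l// ltW.
    by rewrite ler_norml => /andP[? ?]; apply/andP; split; nra.
  apply: (le_trans (lebesgue_outer_open_box _)); rewrite lee_fin.
  rewrite /box_volume -[X in _ <= _ ^+ X](card_ord n.+1) -prodr_const.
  apply: ler_prod => i _; rewrite !mxE/= le_max lexx/= ge_max.
  by apply/andP; split; lra.
apply: (@le_trans _ _ (\sum_(f | P f) ((8 * L * d) ^+ n.+1)%:E)%E).
  by apply: lee_sum => f _; exact: imQ.
rewrite sumEFin lee_fin sumr_const.
have -> : #|P| = (\prod_i m i)%N.
  transitivity #|[set f : {ffun 'I_n.+1 -> 'I_M} | [forall i, (f i < m i)%N]]%SET|.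
    by apply: eq_card => f; rewrite inE.
  rewrite (card_ffun_all (fun i (j : 'I_M) => (j < m i)%N)).
  apply: eq_bigr => i _.
  have mM : (m i <= M)%N by exact: leq_bigmax.
  have widen_inj : injective (widen_ord mM).
    by move=> a b /(congr1 val)/= /val_inj.
  rewrite -[RHS]card_ord -(card_imset _ widen_inj).
  apply: eq_card => j; rewrite inE; apply/idP/imsetP => [jm|[k _ ->]//=].
  by exists (Ordinal jm) => //; apply/val_inj.
rewrite -[leLHS]mulr_natl natr_prod /box_volume.
have powE (x : R) : x ^+ n.+1 = \prod_(i < n.+1) x by rewrite prodr_const card_ord.
rewrite !powE -!big_split/=.
apply: ler_prod => i _; rewrite !mulr_ge0//= ?(ltW L0) ?(ltW d0)//.
apply: (@le_trans _ _ (2 * side ab i / d * (8 * L * d))).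
  by rewrite ler_wpM2r// !mulr_ge0// ltW.
rewrite le_eqVlt; apply/orP; left; apply/eqP; rewrite -/(side ab i); field.
by rewrite gt_eqF.
Qed.

(** Since every box is subdivided below the scale [e], the constant does not depend on [e], and a
    Lipschitz bound for nearby points suffices. The infimum over the covers of [A] then turns box
    volumes into outer measure. *)
Lemma lebesgue_outer_image_le (A : set V) (psi : V -> V) (L e : R) :
  0 < L -> 0 < e ->
  (forall x y, A x -> A y -> `|x - y| < e -> `|psi x - psi y| <= L * `|x - y|) ->
  (outer (psi @` A) <= ((16 * L) ^+ n.+1)%:E * outer A)%E.
Proof.
move=> L0 e0 lip.
have c0 : 0 < (16 * L) ^+ n.+1 by rewrite exprn_gt0// mulr_gt0.
rewrite muleC -lee_pdivrMr//; apply: le_ereal_inf_tmp => _ [F AF <-].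
rewrite lee_pdivrMr// muleC -nneseriesZl; last first.
  by move=> k _; rewrite lee_fin box_volume_ge0.
apply: (@le_trans _ _ (\sum_(k <oo) outer (psi @` (A `&` open_box (F k))))%E).
  apply: (le_trans _ (outer_measure_sigma_subadditive _ _)).
  apply: le_outer_measure => _ [x Ax <-].
  by have [k _ Fx] := AF _ Ax; exists k => //; exists x.
apply: lee_nneseries => [k _ _|k _]; first exact: outer_measure_ge0.
by rewrite -EFinM; exact: (lebesgue_outer_image_box _ L0 e0).
Qed.

End OuterMeasure.

(** * Measurability of open sets *)

Section Measurability.
Context {R : realType} {n : nat}.
Local Notation V := 'rV[R]_n.+1.
Local Notation outer := (lebesgue_outer : {outer_measure set V -> \bar R}).
Local Notation U := (caratheodory_type outer).

Definition set_coord (x : V) (i : 'I_n.+1) (c : R) : V :=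
  \row_j if j == i then c else x 0 j.

Lemma box_volume_coord (ab : V * V) i : box_volume ab =
  side ab i * \prod_(j | j != i) side ab j.
Proof. by rewrite /box_volume (bigD1 i). Qed.

Lemma lebesgue_outer_hyperplane_box (ab : V * V) i c :
  outer (open_box ab `&` [set x | x 0 i = c]) = 0%E.
Proof.
apply/eqP; rewrite eq_le outer_measure_ge0 andbT.
apply/lee_addgt0Pr => e e0; rewrite add0e.
pose p := \prod_(j | j != i) side ab j.
have p0 : 0 <= p by apply: prodr_ge0 => j _; exact: side_ge0.
(* The hyperplane section lies in a slab of volume [2 * d * p], which is below [e]; the added 1
   covers the case [p = 0]. *)
pose d := e / (2 * (p + 1)).
have d0 : 0 < d by rewrite divr_gt0// mulr_gt0// ltr_wpDl.
pose ab' := (set_coord ab.1 i (c - d), set_coord ab.2 i (c + d)).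
apply: (@le_trans _ _ (outer (open_box ab'))).
  apply: le_outer_measure => x [abx /= xc] j; rewrite !mxE.
  by case: eqP => [->|_]; [rewrite xc; apply/andP; split; lra|exact: abx].
apply: (le_trans (lebesgue_outer_open_box _)); rewrite lee_fin.
rewrite (box_volume_coord _ i) (eq_bigr (side ab)); last first.
  by move=> j ji; rewrite /side !mxE (negbTE ji).
rewrite -/p /side !mxE eqxx.
have -> : c + d - (c - d) = 2 * d by lra.
rewrite max_r; last by rewrite mulr_ge0// ltW.
rewrite /d; have p1 : 0 < p + 1 by rewrite ltr_wpDl.
rewrite (_ : _ * p = e * (p / (p + 1))); last by field; rewrite gt_eqF.
by rewrite ger_pMr// ler_pdivrMr//; lra.
Qed.

(** The hyperplane cuts each box of a cover into two boxes whose volumes add up exactly. The two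
    open halves miss only the hyperplane itself, whose part inside each box is null. *)
Lemma halfspace_caratheodory i c : outer.-caratheodory [set x : V | x 0 i < c].
Proof.
apply: le_caratheodory_measurable => X.
apply: le_ereal_inf_tmp => _ [F XF <-].
pose lo k := ((F k).1, set_coord (F k).2 i (Num.min c ((F k).2 0 i))).
pose hi k := (set_coord (F k).1 i (Num.max c ((F k).1 0 i)), (F k).2).
have volE k : box_volume (F k) = box_volume (lo k) + box_volume (hi k).
  have others G : (forall j, j != i -> side G j = side (F k) j) ->
      box_volume G = side G i * \prod_(j | j != i) side (F k) j.
    by move=> GF; rewrite (box_volume_coord _ i); congr (_ * _); exact: eq_bigr.
  rewrite (box_volume_coord _ i) (others (lo k)) 1?(others (hi k)).
  - rewrite -mulrDl; congr (_ * _); rewrite /side /lo /hi !mxE eqxx.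
    by rewrite /Order.max /Order.min; repeat case: ifPn; lra.
  - by move=> j ji; rewrite /side /hi !mxE (negbTE ji).
  - by move=> j ji; rewrite /side /lo !mxE (negbTE ji).
have vol0 (G : nat -> V * V) k : (0 <= (box_volume (G k))%:E)%E.
  by rewrite lee_fin box_volume_ge0.
apply: (@le_trans _ _ (\sum_(k <oo) (box_volume (lo k))%:E
   + \sum_(k <oo) (box_volume (hi k))%:E)%E); last first.
  rewrite -nneseriesD//; apply: lee_nneseries => [k _ _|k _]; first exact: adde_ge0.
  by rewrite -EFinD -volE.
apply: leeD.
  apply: ereal_inf_lbound; exists lo => // x [Xx /= xc].
  have [k _ Fx] := XF _ Xx; exists k => // j.
  rewrite mxE/=; have /andP[-> xb] := Fx j.
  by case: eqP => // ji; rewrite ji in xb *; rewrite lt_min xc.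
apply: (@le_trans _ _ (outer (\bigcup_k open_box (hi k)) +
    outer (\bigcup_k (open_box (F k) `&` [set x : V | x 0%R i = c])))%E).
  apply: (le_trans _ (outer_measureU2 _ _ _)).
  apply: le_outer_measure => x [Xx /= /negP]; rewrite -leNgt le_eqVlt.
  have [k _ Fx] := XF _ Xx.
  case/predU1P => cx; [right|left]; exists k => //=.
  move=> j; rewrite mxE/=; have /andP[ax ->] := Fx j; rewrite andbT.
  by case: eqP => // ji; rewrite ji in ax *; rewrite gt_max cx.
rewrite (_ : outer (\bigcup_k (_ `&` _)) = 0%E); last first.
  apply/eqP; rewrite eq_le outer_measure_ge0 andbT.
  apply: (le_trans (outer_measure_sigma_subadditive _ _)).
  rewrite eseries0// => k _ _; exact: lebesgue_outer_hyperplane_box.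
rewrite adde0.
apply: (le_trans (outer_measure_sigma_subadditive _ _)).
by apply: lee_nneseries => [k _ _|k _];
  [exact: outer_measure_ge0|exact: lebesgue_outer_open_box].
Qed.

Lemma measurable_open_box (ab : V * V) : measurable (open_box ab : set U).
Proof.
have mlt i c : measurable ([set x | x 0 i < c] : set U).
  exact: halfspace_caratheodory.
have mgt i c : measurable ([set x | c < x 0 i] : set U).
  rewrite (_ : [set x | c < x 0 i] =
      ~` (\bigcap_(m : nat) [set x | x 0 i < c + m.+1%:R^-1])).
    apply: measurableC; apply: bigcapT_measurable => m; exact: mlt.
  apply/seteqP; split => x /=.
    move=> cx /(_ (Num.truncn (x 0 i - c)^-1) I) /=.
    apply/negP; rewrite -leNgt -lerBrDl.
    rewrite -[leRHS]invrK lef_pV2 ?posrE ?invr_gt0 ?subr_gt0//.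
    by rewrite ltW// truncnS_gt.
  move=> h; rewrite ltNge; apply/negP => xc; apply: h => m _ /=.
  by rewrite (le_lt_trans xc)// ltrDl.
rewrite (_ : open_box ab = ~` \bigcup_(i : 'I_n.+1)
    ~` ([set x | ab.1 0 i < x 0 i] `&` [set x | x 0 i < ab.2 0 i])).
  apply: measurableC; apply: countable_bigcupT_measurable => [|i].
    exact: countableP.
  by apply: measurableC; apply: measurableI.
rewrite setC_bigcup; apply/seteqP; split => x.
  by move=> abx i _; rewrite setCK /=; have /andP[? ?] := abx i.
by move=> abx i; have := abx i I; rewrite setCK => -[/= -> ->].
Qed.

Definition rat_box (q : 'rV[rat]_n.+1 * 'rV[rat]_n.+1) : V * V :=
  (map_mx ratr q.1, map_mx ratr q.2).

(** Rational boxes form a countable base. This serves twice: for the measurability of open sets, and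
    later to cut the contact set into countably many pieces. *)
Lemma rat_box_nbhs (A : set V) x : nbhs x A ->
  exists q, open_box (rat_box q) x /\ open_box (rat_box q) `<=` A.
Proof.
move=> /nbhs_ballP[e /= e0 xA].
have /choice[l lP] : forall i, exists q : rat, x 0 i - e < ratr q < x 0 i.
  move=> i; have /rat_in_itvoo[q] : x 0 i - e < x 0 i by lra.
  by rewrite in_itv; exists q.
have /choice[r rP] : forall i, exists q : rat, x 0 i < ratr q < x 0 i + e.
  move=> i; have /rat_in_itvoo[q] : x 0 i < x 0 i + e by lra.
  by rewrite in_itv; exists q.
exists (\row_i l i, \row_i r i); split => [i|y yb].
  by rewrite !mxE; have /andP[_ ->] := lP i; have /andP[-> _] := rP i.
apply: xA; rewrite -ball_normE/=.
apply: norm_lt_coord => // i; have := yb i; rewrite !mxE => /andP[? ?].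
have /andP[? ?] := lP i; have /andP[? ?] := rP i.
by rewrite ltr_norml; apply/andP; split; lra.
Qed.

Lemma measurable_open (A : set V) : open A -> measurable (A : set U).
Proof.
move=> oA.
rewrite (_ : A = \bigcup_(q in [set q | open_box (rat_box q) `<=` A])
   open_box (rat_box q)).
  rewrite bigcup_mkcond; apply: countable_bigcupT_measurable => [|q].
    exact: countableP.
  by case: ifP => _; [exact: measurable_open_box|exact: measurable0].
apply/seteqP; split => [x Ax|x [q] qA /qA//].
by have [q [qx qA]] := rat_box_nbhs (open_nbhs_nbhs (conj oA Ax)); exists q.
Qed.

Lemma measurable_fun_open (Om : set V) (f : V -> R) : open Om ->
  (forall x, Om x -> {for x, continuous f}) ->
  measurable_fun (Om : set U) (f : U -> R).
Proof.
move=> oOm cf mOm; apply: (measurability _ (RGenOInfty.measurableE R)).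
move=> _ [_ [c ->] <-]; apply: measurable_open; rewrite openE => x [Omx].
rewrite /= in_itv/= andbT => cfx; apply: filterI; first exact: open_nbhs_nbhs.
near=> y; rewrite /= in_itv/= andbT; near: y.
exact: (cvgr_gt _ (cf _ Omx)).
Unshelve. all: by end_near. Qed.

End Measurability.

(** * Pucci operator of a rank-one perturbation of a scalar matrix *)

Section RankOne.

(** Two block eliminations of the bordered matrix [M] compute its determinant in two ways. Only a
    cancellation of [t] occurs, no inverse, so the identity can be used over polynomials with [t]
    equal to 'X minus a constant. *)
Lemma det_scalar_sub_rank1 (R : idomainType) (n : nat) (t : R)
    (c : 'cV[R]_n.+1) (r : 'rV[R]_n.+1) : t != 0 ->
  \det (t%:M - c *m r) = (t - (r *m c) 0 0) * t ^+ n.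
Proof.
move=> t0; pose M : 'M[R]_(1 + n.+1) := block_mx 1%:M r c t%:M.
have detM : \det M = \det (t%:M - c *m r).
  have : \det (M *m block_mx 1%:M (- r) 0 1%:M) = \det (t%:M - c *m r).
    rewrite mulmx_block !mulmx1 !mulmx0 mul1mx addNr !addr0 mulmxN.
    by rewrite det_lblock det1 mul1r addrC.
  by rewrite det_mulmx det_ublock !det1 !mulr1.
have : \det (M *m block_mx t%:M 0 (- c) 1%:M) = (t - (r *m c) 0 0) * t ^+ n.+1.
  rewrite mulmx_block !mulmx1 !mulmx0 mul1mx !add0r !mulmxN.
  rewrite mul_mx_scalar mul_scalar_mx subrr det_ublock det_scalar.
  by rewrite det_mx11 !mxE eqxx.
rewrite det_mulmx det_lblock det1 mulr1 det_scalar expr1 detM => e.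
by apply: (mulIf t0); rewrite e exprSr mulrA.
Qed.

Lemma char_poly_scalar_add_rank1 (R : fieldType) (n : nat) (c d : R)
    (e : 'rV[R]_n.+1) : (e *m e^T) 0 0 = 1 ->
  char_poly (c%:M + d *: (e^T *m e)) =
  \prod_(x <- (c + d) :: nseq n c) ('X - x%:P).
Proof.
move=> e1; rewrite /char_poly.
have -> : char_poly_mx (c%:M + d *: (e^T *m e)) =
    ('X - c%:P)%:M - map_mx polyC (d *: e^T) *m map_mx polyC e.
  rewrite /char_poly_mx -map_mxM -scalemxAl map_mxD map_scalar_mx/=.
  by rewrite opprD addrA raddfB.
rewrite det_scalar_sub_rank1 ?polyXsubC_eq0//.
rewrite big_cons big_nseq iter_mulr mulr1; congr (_ * _).
rewrite -map_mxM mxE -scalemxAr mxE e1 mulr1.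
by rewrite polyCD opprD addrA.
Qed.

End RankOne.

Lemma dotvE {R : realType} {N : nat} (x y : 'rV[R]_N) :
  dotv x y = (x *m y^T) 0 0.
Proof. by rewrite mxE; apply: eq_bigr => i _; rewrite mxE. Qed.

Section Pucci.
Context {R : realType} {n : nat}.
Local Notation V := 'rV[R]_n.+1.
Implicit Types (x y e p : V).

Lemma pucci_scalar_add_rank1 (c d vt vT : R) e : c <= 0 -> 0 <= c + d ->
  dotv e e = 1 ->
  pucci_minus (c%:M + d *: (e^T *m e)) vt vT = vt * (c + d) + vT * (n%:R * c).
Proof.
move=> c0 cd0 e1; set A := _ + _.
(* [eigenvalues] picks some list of roots; unique factorization of the characteristic polynomial
   determines it up to order, which the two sums do not see. *)
have eigP : perm_eq (eigenvalues A) ((c + d) :: nseq n c).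
  apply: prod_XsubC_eq.
  have cA : char_poly A = \prod_(x <- (c + d) :: nseq n c) ('X - x%:P).
    by apply: char_poly_scalar_add_rank1; rewrite -dotvE.
  rewrite -cA /eigenvalues; case: xgetP => [s _ /= -> //|/(_ _ cA)//].
rewrite /pucci_minus !(perm_big _ eigP)/= !big_cons; congr (_ * _ + _ * _).
- rewrite big_nseq_cond [0 < c]ltNge c0/= addr0.
  by case: ltgtP cd0.
- rewrite big_nseq_cond [c + d < 0]ltNge cd0/=.
  have [_|c1] := ltP c 0; first by rewrite iter_addr_0 mulr_natl.
  by rewrite (le_anti (introT andP (conj c0 c1))) mulr0.
Qed.

End Pucci.

(** * Quadratic test functions *)

Section Dotv.
Context {R : realType} {N : nat}.
Implicit Types (x y z v : 'rV[R]_N) (Q : 'M[R]_N) (f : 'rV[R]_N -> R).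

Lemma dotvC x y : dotv x y = dotv y x.
Proof. by apply: eq_bigr => i _; rewrite mulrC. Qed.

Lemma dotvDl x y z : dotv (x + y) z = dotv x z + dotv y z.
Proof. by rewrite -big_split; apply: eq_bigr => i _; rewrite mxE mulrDl. Qed.

Lemma dotvZl c x y : dotv (c *: x) y = c * dotv x y.
Proof. by rewrite /dotv mulr_sumr; apply: eq_bigr => i _; rewrite mxE mulrA. Qed.

Lemma dotvNl x y : dotv (- x) y = - dotv x y.
Proof. by rewrite -scaleN1r dotvZl mulN1r. Qed.

Lemma dotvBl x y z : dotv (x - y) z = dotv x z - dotv y z.
Proof. by rewrite dotvDl dotvNl. Qed.

Lemma dotvDr x y z : dotv x (y + z) = dotv x y + dotv x z.
Proof. by rewrite dotvC dotvDl !(dotvC x). Qed.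

Lemma dotvZr c x y : dotv x (c *: y) = c * dotv x y.
Proof. by rewrite dotvC dotvZl (dotvC x). Qed.

Lemma dotvNr x y : dotv x (- y) = - dotv x y.
Proof. by rewrite dotvC dotvNl (dotvC x). Qed.

Lemma dotvBr x y z : dotv x (y - z) = dotv x y - dotv x z.
Proof. by rewrite dotvDr dotvNr. Qed.

Lemma dotv0r x : dotv x 0 = 0.
Proof. by rewrite /dotv big1// => i _; rewrite mxE mulr0. Qed.

Lemma dotv_ge0 x : 0 <= dotv x x.
Proof. by apply: sumr_ge0 => i _; rewrite -expr2 sqr_ge0. Qed.

Lemma dotv_delta x i : dotv x (delta_mx 0 i) = x 0 i.
Proof.
rewrite /dotv (bigD1 i)//= mxE !eqxx mulr1 big1 ?addr0// => j ji.
by rewrite mxE (negbTE ji) andbF mulr0.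
Qed.

Lemma coord_sqr_le_dotv x i : x 0 i ^+ 2 <= dotv x x.
Proof.
rewrite /dotv (bigD1 i)//= -expr2 lerDl sumr_ge0// => j _.
by rewrite -expr2 sqr_ge0.
Qed.

Lemma sqr_dotv_le e x : dotv e e = 1 -> dotv e x ^+ 2 <= dotv x x.
Proof.
move=> e1; have := dotv_ge0 (x - dotv e x *: e).
rewrite dotvBl !dotvBr !dotvZl !dotvZr e1 (dotvC x e) => h; nra.
Qed.

Lemma dotv_mulmx_sym Q x y : Q^T = Q -> dotv (x *m Q) y = dotv (y *m Q) x.
Proof.
move=> sQ; rewrite !dotvE -[RHS]trace_mx11 -mxtrace_tr trace_mx11.
by rewrite !trmx_mul sQ trmxK mulmxA.
Qed.

(** The factor N is the price of measuring [y] in the sup norm. It reappears in the side of the cube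
    of slopes and in the width of the barrier slab. *)
Lemma dotv_le_norm x y a : 0 <= a -> (forall i, `|x 0 i| <= a) ->
  `|dotv x y| <= N%:R * (a * `|y|).
Proof.
move=> a0 xa; apply: (le_trans (ler_norm_sum _ _ _)).
rewrite -[X in X%:R](card_ord N) mulr_natl -sumr_const; apply: ler_sum => i _.
rewrite normrM ler_pM//.
by rewrite [leRHS]/Num.norm/= mx_normrE (le_bigmax _ _ (0, i)).
Qed.

Lemma differentiable_dotv p x : differentiable (dotv p) x.
Proof.
rewrite (_ : dotv p = \sum_(i < N) (fun y : 'rV[R]_N => p 0 i * y 0 i)).
  by apply: differentiable_sum => i; apply: differentiableM => //;
    exact: differentiable_coord.
by apply/funext => y; rewrite fct_sumE.
Qed.

(** On every line the test functions are polynomials of degree at most two, so their gradient and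
    Hessian can be read off from an expansion. *)
Lemma derive_quadratic_expansion f x v A B :
  (forall h : R, f (x + h *: v) = f x + h * A + h ^+ 2 * B) -> 'D_v f x = A.
Proof.
move=> fE; apply/cvg_lim => //=.
have : (A + h * B) @[h --> 0^'] --> A + 0 * B.
  apply: cvgD; first exact: cvg_cst.
  by apply: cvgMl; exact: cvg_within.
rewrite mul0r addr0; apply: cvg_trans.
apply: near_eq_cvg; near=> h.
have h0 : h != 0 by near: h; exact: nbhs_dnbhs_neq.
rewrite /= [h *: v + x]addrC fE /GRing.scale/=.
by field.
Unshelve. all: by end_near. Qed.

Definition quad (k : R) p Q (x0 y : 'rV[R]_N) : R :=
  k + dotv p (y - x0) + dotv ((y - x0) *m Q) (y - x0).

Lemma grad_quad k p Q x0 y : Q^T = Q ->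
  grad (quad k p Q x0) y = p + 2 *: ((y - x0) *m Q).
Proof.
move=> sQ; apply/rowP => i; rewrite !mxE.
rewrite (@derive_quadratic_expansion _ _ _
  (p 0 i + 2 * ((y - x0) *m Q) 0 i) (dotv (delta_mx 0 i *m Q) (delta_mx 0 i))).
  by rewrite mxE.
move=> h; rewrite /quad [y + _ - x0]addrAC; move: (y - x0) => z.
rewrite mulmxDl !dotvDl !dotvDr -scalemxAl !dotvZl !dotvZr !dotv_delta.
rewrite (dotv_mulmx_sym (delta_mx 0 i))// dotv_delta.
ring.
Qed.

Lemma hess_quad k p Q x0 y : Q^T = Q -> hess (quad k p Q x0) y = 2 *: Q.
Proof.
move=> sQ; apply/matrixP => i j; rewrite !mxE.
have -> : (fun y => grad (quad k p Q x0) y 0 j) =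
    (fun y => p 0 j + 2 * ((y - x0) *m Q) 0 j).
  by apply/funext => z; rewrite grad_quad// !mxE.
rewrite (@derive_quadratic_expansion _ _ _ (2 * Q i j) 0)// => h.
rewrite [y + _ - x0]addrAC mulmxDl [in LHS]mxE -scalemxAl -rowE !mxE.
ring.
Qed.

Lemma differentiable_quad k p Q x0 y : differentiable (quad k p Q x0) y.
Proof.
have -> : quad k p Q x0 = (fun y => k + dotv p (y - x0) +
    \sum_(i < N) dotv (row i Q^T) (y - x0) * (y - x0) 0 i).
  apply/funext => z; rewrite /quad; congr (_ + _); apply: eq_bigr => i _.
  by rewrite [in LHS]mxE; congr (_ * _); apply: eq_bigr => j _; rewrite !mxE mulrC.
have dd q : differentiable (fun y => dotv q (y - x0)) y.
  apply: (differentiable_comp _ (differentiable_dotv q _)).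
  exact: differentiableB.
apply: differentiableD.
  by apply: differentiableD.
rewrite -fct_sumE.
apply: differentiable_sum => i; apply: differentiableM => //.
by under eq_fun do rewrite -dotv_delta dotvC.
Qed.

Lemma C2_on_quad (Om : set 'rV[R]_N) k p Q x0 : Q^T = Q ->
  C2_on Om (quad k p Q x0).
Proof.
move=> sQ x _; split => [|j|i j].
- exact: differentiable_quad.
- have -> : (fun y => grad (quad k p Q x0) y 0 j) =
      quad (p 0 j) (row j (2 *: Q^T)) 0 x0.
    apply/funext => z; rewrite grad_quad// /quad mulmx0 (dotvC 0) dotv0r addr0.
    rewrite !mxE; congr (_ + _); rewrite mulr_sumr; apply: eq_bigr => i _.
    by rewrite !mxE; ring.
  exact: differentiable_quad.
- have -> : (fun y => hess (quad k p Q x0) y i j) = (fun=> (2 *: Q) i j).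
    by apply/funext => y; rewrite hess_quad.
  exact: (@cst_continuous _ _ ((2 *: Q) i j) x).
Qed.

End Dotv.

(** * Barrier at contact points *)

Section Barrier.
Context {R : realType} {n : nat}.
Local Notation V := 'rV[R]_n.+1.
Implicit Types (Om : set V) (u g : V -> R) (x y z e : V).

Lemma sup_ball_compact x (a : R) :
  compact [set y : V | forall i, `|y 0 i - x 0 i| <= a].
Proof.
rewrite (_ : mkset _ =
    [set y : V | forall i, `[x 0 i - a, x 0 i + a]%classic (y 0 i)]).
  apply: (@rV_compact _ _ (fun i => `[x 0 i - a, x 0 i + a]%classic)) => i.
  exact: segment_compact.
apply/seteqP; split => y h i; have := h i; rewrite /= in_itv/= ler_norml.
  by move=> /andP[? ?]; apply/andP; split; lra.
by move=> /andP[? ?]; apply/andP; split; lra.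
Qed.

Lemma norm_le_coord x (a : R) : 0 <= a -> (forall i, `|x 0 i| <= a) -> `|x| <= a.
Proof.
move=> a0 xa; rewrite [leLHS]/Num.norm/= mx_normrE.
by apply/bigmax_leP; split => // -[j i] _; rewrite ord1.
Qed.

(** Chosen so that [b * T = 4 * a] for the barrier coefficients below: on the lateral face
    [W = T r^2] the term [b W] then compensates [a (L + r)^2], which is at most [4 a r^2] in the
    slab. *)
Definition barrier_ratio (vt vT : R) : R := 8 * vT * n.+1%:R / vt.

(* The barrier [a (L + r)^2 - b W], with [L] the coordinate along [e] and [W] the
   squared distance to the axis, is too convex to touch [u] from below in the
   slab [|L| <= r], [W <= T r^2]. As [u] lies above the affine functions given by
   the two contact points, a large slope [s] would force such a touching. *)
Lemma contact_slope_bound Om (vt vT : R) g u x0 x1 e (s r K : R) :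
  0 < vt -> vt <= vT -> Mminus_class Om vt vT g u ->
  lower_contact Om u x0 -> lower_contact Om u x1 ->
  dotv e e = 1 -> grad u x1 - grad u x0 = s *: e ->
  0 < r -> `|dotv e (x1 - x0)| <= r / 2 -> 0 < K ->
  (forall y, `|y - x0| <= (barrier_ratio vt vT + 1) * r -> Om y /\ g y <= K) ->
  s < 8 * K / vt * r.
Proof.
move=> vt0 vtT [uc uM] [Om0 u0] [Om1 u1] e1 se r0 x1r K0.
set T := barrier_ratio vt vT => ball_sub.
have vT0 : 0 < vT by exact: lt_le_trans vtT.
have N0 : 0 < n.+1%:R :> R by [].
have T0 : 0 <= T by rewrite /T/barrier_ratio !mulr_ge0// ?invr_ge0 ltW.
(* The Hessian of the barrier has the eigenvalue [2 a] once and [- 2 b] n times. With these values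
   its Pucci operator is [2 K - n K / (n + 1)], strictly above the bound [K] on [g]. *)
pose a := K / vt; pose b := K / (2 * vT * n.+1%:R).
have a0 : 0 < a by rewrite divr_gt0.
have b0 : 0 < b by rewrite divr_gt0// !mulr_gt0.
have bT : b * T = 4 * a.
  by rewrite /b /T /a /barrier_ratio; field; rewrite !gt_eqF.
rewrite ltNge; apply/negP => s_ge.
have {}s_ge : 8 * a * r <= s by rewrite /a mulrA in s_ge *.
pose L y := dotv e (y - x0).
pose W y := dotv (y - x0) (y - x0) - L y ^+ 2.
have W0 y : 0 <= W y by rewrite subr_ge0 sqr_dotv_le.
pose Q : 'M[R]_n.+1 := (- b)%:M + (a + b) *: (e^T *m e).
have sQ : Q^T = Q.
  apply/matrixP => i j; rewrite !mxE !big_ord1 !mxE eq_sym.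
  by rewrite [e 0 i * _]mulrC.
pose phi := quad (u x0 + a * r ^+ 2) (grad u x0 + (2 * a * r) *: e) Q x0.
have phiE y : phi y = u x0 + dotv (grad u x0) (y - x0) +
    a * (L y + r) ^+ 2 - b * W y.
  rewrite /phi /quad dotvDl dotvZl /W /L; move: (y - x0) => z.
  have -> : dotv (z *m Q) z = - b * dotv z z + (a + b) * dotv e z ^+ 2.
    rewrite /Q mulmxDr mul_mx_scalar dotvDl dotvZl; congr (_ + _).
    rewrite -scalemxAr dotvZl; congr (_ * _).
    rewrite mulmxA [z *m e^T]mx11_scalar mul_scalar_mx dotvZl -dotvE.
    by rewrite (dotvC z e) expr2.
  ring.
have cL : continuous L.
  move=> y; apply: differentiable_continuous.
  apply: (differentiable_comp _ (differentiable_dotv e _)).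
  exact: differentiableB.
have cW : continuous W.
  move=> y; apply: differentiable_continuous.
  have -> : W = quad 0 0 (1%:M - e^T *m e) x0.
    apply/funext => z; rewrite /quad add0r (dotvC 0) dotv0r add0r.
    rewrite mulmxBr mulmx1 dotvBl /W /L; congr (_ - _); move: (z - x0) => w.
    rewrite mulmxA [w *m e^T]mx11_scalar mul_scalar_mx dotvZl -dotvE.
    by rewrite (dotvC w e) expr2.
  exact: differentiable_quad.
pose D := [set y | [/\ - r <= L y, L y <= r & W y <= T * r ^+ 2]].
(* The squared Euclidean distance to [x0] is [W + L^2], at most [(T + 1) r^2]; since [T + 1 >= 1],
   the radius [(T + 1) r] avoids a square root. *)
have D_ball y : D y -> forall i, `|y 0 i - x0 0 i| <= (T + 1) * r.
  move=> [L1 L2 Wy] i.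
  have := coord_sqr_le_dotv (y - x0) i; rewrite !mxE => h.
  have {}h : (y 0 i - x0 0 i) ^+ 2 <= ((T + 1) * r) ^+ 2.
    apply: (le_trans h).
    have -> : dotv (y - x0) (y - x0) = W y + L y ^+ 2 by rewrite /W subrK.
    have : L y ^+ 2 <= r ^+ 2.
      have := mulr_ge0 (_ : 0 <= r - L y) (_ : 0 <= r + L y); rewrite !subr_ge0.
      by move=> /(_ L2); rewrite -lerBlDl sub0r => /(_ L1); lra.
    have : 0 <= T * T * r ^+ 2 by rewrite mulr_ge0 ?sqr_ge0// mulr_ge0.
    have : 0 <= T * r ^+ 2 by rewrite mulr_ge0 ?sqr_ge0.
    lra.
  by rewrite -ler_sqr ?nnegrE ?real_normK ?num_real// mulr_ge0 ?addr_ge0// ltW.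
have D_norm y : D y -> `|y - x0| <= (T + 1) * r.
  move=> Dy; apply: norm_le_coord => [|i]; last by rewrite !mxE D_ball.
  by rewrite mulr_ge0 ?addr_ge0// ltW.
have DOm y : D y -> Om y by move=> /D_norm/ball_sub[].
have Dcompact : compact D.
  have sub : D `<=` [set y : V | forall i, `|y 0 i - x0 0 i| <= (T + 1) * r] := D_ball.
  suff cD : closed D by apply: (subclosed_compact cD _ sub); exact: sup_ball_compact.
  rewrite (_ : D = [set y | - r <= L y] `&` [set y | L y <= r] `&`
      [set y | W y <= T * r ^+ 2]).
    apply: closedI; first apply: closedI.
    - exact: (@preimage_closed _ _ L _ (fun y _ => cL y) (@closed_ge _ (- r))).
    - exact: (@preimage_closed _ _ L _ (fun y _ => cL y) (@closed_le _ r)).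
    - exact: (@preimage_closed _ _ W _ (fun y _ => cW y) (@closed_le _ (T * r ^+ 2))).
  by apply/seteqP; split => [y [? ? ?]|y [[? ?] ?]]; split => //; split.
have Dx0 : D x0.
  rewrite /D /= /W /L subrr !dotv0r expr0n/= subr0.
  split; [by rewrite oppr_le0 ltW|exact: ltW|].
  by rewrite mulr_ge0// sqr_ge0.
have : {within D, continuous (fun y => u y - phi y)}.
  apply: continuous_in_subspaceT => y /set_mem/DOm Omy.
  apply: (@continuousB _ _ _ u phi y); first exact: uc.
  by apply: differentiable_continuous; exact: differentiable_quad.
have D0 : D !=set0 by exists x0.
move=> /(EVT_min_rV D0 Dcompact)[z /set_mem Dz zmin].
have {}zmin y : D y -> u z - phi z <= u y - phi y.
  by move=> /mem_set/zmin.
(* The value at the centre [x0] is [- a r^2], whereas [u - phi] is nonnegative on every face of the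
   slab. Hence the minimum point [z] is interior. *)
have zneg : u z - phi z <= - (a * r ^+ 2).
  apply: (le_trans (zmin _ Dx0)).
  rewrite phiE /W /L subrr !dotv0r expr0n/= subr0 add0r; lra.
have cl y : D y -> closure Om y by move=> /DOm; exact: subset_closure.
have u_ge y : D y -> - a * (L y + r) ^+ 2 + b * W y <= u y - phi y.
  by move=> Dy; have := u0 _ (cl _ Dy); rewrite phiE; lra.
have ar2 : 0 < a * r ^+ 2 by rewrite mulr_gt0// exprn_gt0.
have [Lz1 Lz2 Wz] := Dz.
have Lz1' : - r < L z.
  rewrite lt_neqAle Lz1 andbT; apply/eqP => Lr.
  have := u_ge _ Dz; rewrite -Lr addNr expr0n/= mulr0 add0r.
  have := mulr_ge0 (ltW b0) (W0 z); lra.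
have Wz' : W z < T * r ^+ 2.
  rewrite lt_neqAle Wz andbT; apply/eqP => Wr.
  have := u_ge _ Dz; rewrite Wr mulrA bT.
  have : (L z + r) ^+ 2 <= 4 * r ^+ 2 by nra.
  nra.
(* Only this face uses [x1]. Chaining the contact inequalities from [x0] to [x1] and from [x1] to
   [z] gains [s (L z - L x1)] over the tangent plane at [x0]. As [L x1 <= r / 2], the gain is at
   least [s r / 2], hence at least [4 a r^2], the height of the barrier there. *)
have Lz2' : L z < r.
  rewrite lt_neqAle Lz2 andbT; apply/eqP => Lr.
  have := u1 _ (cl _ Dz).
  have := u0 _ (subset_closure Om1).
  have -> : grad u x1 = grad u x0 + s *: e by rewrite -se addrC subrK.
  rewrite dotvDl dotvZl !dotvBr.
  move: x1r Lr (mulr_ge0 (ltW b0) (W0 z)) zneg; rewrite phiE ler_norml.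
  rewrite /L !dotvBr => /andP[_ x1r] Lr bW zneg h0 h1.
  have : s * (r / 2) <= s * (dotv e z - dotv e x1).
    apply: ler_wpM2l; last by lra.
    by apply: le_trans s_ge; apply/ltW; rewrite mulr_gt0// mulr_gt0.
  have : 4 * a * r ^+ 2 <= s * (r / 2) by nra.
  by rewrite Lr in zneg; lra.
have near_min : \forall y \near z, u z - phi z <= u y - phi y.
  have h1 : \forall y \near z, - r < L y by exact: (cvgr_gt _ (cL z) _ Lz1').
  have h2 : \forall y \near z, L y < r by exact: (cvgr_lt _ (cL z) _ Lz2').
  have h3 : \forall y \near z, W y < T * r ^+ 2 by exact: (cvgr_lt _ (cW z) _ Wz').
  near=> y; apply: zmin; split; apply: ltW.
  - by near: y.
  - by near: y.
  - by near: y.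
have C2 : C2_on Om phi by exact: C2_on_quad.
have := uM z phi (DOm _ Dz) C2 near_min.
have [_ gK] := ball_sub _ (D_norm _ Dz).
move=> /le_trans/(_ gK); rewrite hess_quad//.
have -> : 2 *: Q = (- 2 * b)%:M + (2 * (a + b)) *: (e^T *m e).
  by rewrite /Q scalerDr scale_scalar_mx scalerA mulrN mulNr.
rewrite pucci_scalar_add_rank1//; [|nra|nra].
have -> : vt * (- 2 * b + 2 * (a + b)) = 2 * K.
  by rewrite /a; field; rewrite gt_eqF.
have -> : vT * (n%:R * (- 2 * b)) = - (n%:R * (K / n.+1%:R)).
  by rewrite /b; field; rewrite !gt_eqF.
rewrite leNgt => /negP; apply.
have -> : n%:R * (K / n.+1%:R) = K - K / n.+1%:R.
  by rewrite -natr1; field; rewrite natr1.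
have : 0 < K / n.+1%:R by rewrite divr_gt0.
by move: (K / _) => q q0; lra.
Unshelve. all: by end_near. Qed.

End Barrier.

(** * Local Lipschitz bound for the gradient on the contact set *)

Section Lipschitz.
Context {R : realType} {n : nat}.
Local Notation V := 'rV[R]_n.+1.

(** The factor [8 / vt] of the slope bound, times the ratio [2 N] of the slab half-width [r] to the
    distance of the two contact points. *)
Definition slope_constant (vt : R) : R := 16 * n.+1%:R / vt.

Lemma grad_lipschitz_contact (Om A : set V) (vt vT : R) (g u : V -> R) (d K : R) :
  0 < vt -> vt <= vT -> Mminus_class Om vt vT g u ->
  A `<=` lower_contact Om u -> 0 < d -> 0 < K ->
  (forall x y : V, A x -> `|y - x| < d -> Om y /\ g y <= K) ->
  exists2 e : R, 0 < e & forall x y, A x -> A y -> `|x - y| < e ->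
    `|grad u x - grad u y| <= slope_constant vt * K * `|x - y|.
Proof.
move=> vt0 vtT uM AG d0 K0 Ad.
have vT0 : 0 < vT by exact: lt_le_trans vtT.
have N0 : 0 < n.+1%:R :> R by [].
pose T : R := @barrier_ratio R n vt vT.
have T0 : 0 <= T by rewrite /T/barrier_ratio !mulr_ge0// ?invr_ge0 ltW.
have T1 : 0 < T + 1 by rewrite ltr_wpDl.
(* With [r = 2 N |x1 - x0|], this keeps the ball of radius [(T + 1) r] that the barrier needs within
   distance [d] of [x0]. *)
pose e := d / ((T + 1) * (2 * n.+1%:R)).
exists e; first by rewrite divr_gt0// !mulr_gt0.
move=> x1 x0 A1 A0 x10.
have [->|x1N0] := eqVneq x1 x0; first by rewrite !subrr !normr0 mulr0.
have [xi0|xiN0] := eqVneq (grad u x1 - grad u x0) 0.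
  have C0 : 0 < slope_constant vt * K by rewrite mulr_gt0// divr_gt0// mulr_gt0.
  by rewrite xi0 normr0 mulr_ge0// ltW.
set xi := grad u x1 - grad u x0 in xiN0 *.
pose s := Num.sqrt (dotv xi xi).
have s0 : 0 < s.
  rewrite sqrtr_gt0 lt_neqAle dotv_ge0 andbT eq_sym; apply: contra xiN0 => /eqP xi0.
  apply/eqP/rowP => i; rewrite [RHS]mxE; apply/eqP.
  have := coord_sqr_le_dotv xi i; rewrite xi0 => xi2.
  by rewrite -(@sqrf_eq0 R) eq_le xi2 sqr_ge0.
have s2 : s ^+ 2 = dotv xi xi by rewrite sqr_sqrtr// dotv_ge0.
(* The slab is oriented along the difference of the gradients, not along [x1 - x0]; the choice of
   [r] ensures that [x1] stays in its inner half all the same. *)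
pose w := s^-1 *: xi.
have w1 : dotv w w = 1.
  by rewrite dotvZl dotvZr -s2; field; rewrite gt_eqF.
have x10_gt0 : 0 < `|x1 - x0| by rewrite normr_gt0 subr_eq0.
pose r := 2 * (n.+1%:R * `|x1 - x0|).
have r0 : 0 < r by rewrite !mulr_gt0.
have slope : s < 8 * K / vt * r.
  apply: (contact_slope_bound (x0 := x0) (x1 := x1) (e := w) vt0 vtT uM) => //.
  - exact: AG.
  - exact: AG.
  - by rewrite scalerA mulfV ?gt_eqF// scale1r.
  - have -> : r / 2 = n.+1%:R * (1 * `|x1 - x0|) by rewrite /r; field.
    apply: dotv_le_norm => // i.
    have := coord_sqr_le_dotv w i; rewrite w1 => wi.
    by rewrite -ler_sqr ?nnegrE// real_normK ?num_real// expr1n.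
  - move=> y yx0; apply: (Ad x0) => //; apply: (le_lt_trans yx0).
    rewrite /r -/T; move: x10; rewrite /e ltr_pdivlMr; last by rewrite !mulr_gt0.
    by congr (_ < _); ring.
apply: (@le_trans _ _ s).
  apply: norm_le_coord => [|i]; first exact: ltW.
  have := coord_sqr_le_dotv xi i; rewrite -s2 => xii.
  by rewrite -ler_sqr ?nnegrE ?(ltW s0)// real_normK ?num_real.
apply: ltW; apply: (lt_le_trans slope); rewrite le_eqVlt; apply/orP; left.
by apply/eqP; rewrite /slope_constant /r; field; rewrite gt_eqF.
Qed.

End Lipschitz.

(** * First-order conditions and directional derivatives *)

Section Derivatives.
Context {R : realType} {N : nat}.
Local Notation V := 'rV[R]_N.
Implicit Types (f : V -> R) (x v : V).

Lemma derive_of_min f x v (c : R) : derivable f x v ->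
  (\forall h \near 0, f x + h * c <= f (x + h *: v)) -> 'D_v f x = c.
Proof.
move=> df fmin.
have quot_cvg : (h^-1 *: (f (h *: v + x) - f x)) @[h --> 0^'] --> 'D_v f x := df.
have near_ball (P : set R) : (\forall h \near 0^', P h) -> exists2 d, 0 < d &
    forall h, h != 0 -> `|h| < d -> P h /\ f x + h * c <= f (x + h *: v).
  move=> P0; have : \forall h \near 0, h != 0 -> P h /\ f x + h * c <= f (x + h *: v).
    exact: filterI P0 (nbhs_dnbhs fmin).
  move=> /nbhs_ballP[d /= d0 dP]; exists d => // h h0 hd.
  by apply: dP => //; rewrite -ball_normE/= sub0r normrN.
(* A negative increment bounds the derivative from above, a positive one from below. *)
apply/eqP; rewrite eq_le; apply/andP; split; rewrite leNgt; apply/negP => Dc.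
  have [d d0 dP] := near_ball _ (cvgr_gt _ quot_cvg _ Dc).
  have [||] := dP (- (d / 2)); first by rewrite lt_eqF; lra.
    by rewrite normrN ger0_norm; lra.
  rewrite [_ + x]addrC /GRing.scale/= ltr_ndivlMl; last lra.
  lra.
have [d d0 dP] := near_ball _ (cvgr_lt _ quot_cvg _ Dc).
have [||] := dP (d / 2); first by rewrite gt_eqF; lra.
  by rewrite ger0_norm; lra.
rewrite [_ + x]addrC /GRing.scale/= ltr_pdivrMl; last lra.
lra.
Qed.

Lemma derive_grad f x v : differentiable f x -> 'D_v f x = dotv (grad f x) v.
Proof.
move=> df; rewrite deriveE//.
have {1}-> : v = \sum_i v 0 i *: delta_mx 0 i by exact: row_sum_delta.
rewrite raddf_sum; apply: eq_bigr => i _.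
by rewrite [LHS]linearZ mxE deriveE// mulrC.
Qed.

End Derivatives.

(** * Slopes of contact points *)

Section ContactSlope.
Context {R : realType} {n : nat}.
Local Notation V := 'rV[R]_n.+1.
Implicit Types (Om : set V) (u : V -> R) (Du : V -> V) (x v : V).

Lemma closure_bounded_compact Om : bounded_set Om -> compact (closure Om).
Proof.
move=> [M [Mreal OmM]].
have cM : closed [set x : V | `|x| <= M + 1].
  exact: (@preimage_closed _ _ (fun x : V => `|x|) _
    (fun x _ => @norm_continuous _ _ x) (@closed_le _ (M + 1))).
apply: bounded_closed_compact; last exact: closed_closure.
exists (M + 1); split; first exact: num_real.
move=> a Ma x /= xOm; apply: le_trans (ltW Ma).
apply: cM; apply: closureS xOm => y Omy.
by apply: OmM => //; lra.
Qed.

Lemma norm_le1_unit v : dotv v v = 1 -> `|v| <= 1.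
Proof.
move=> v1; apply: norm_le_coord => // i.
have := coord_sqr_le_dotv v i; rewrite v1 => vi.
by rewrite -ler_sqr ?nnegrE// real_normK ?num_real// expr1n.
Qed.

Lemma line_cvg x v : x + t *: v @[t --> (0 : R)] --> x.
Proof.
have : x + t *: v @[t --> (0 : R)] --> x + 0 *: v.
  by apply: cvgD; [exact: cvg_cst|apply: cvgZr_tmp; exact: cvg_id].
by rewrite scale0r addr0.
Qed.

Lemma line_cvg_right x v : x - t *: v @[t --> 0^'+] --> x.
Proof.
apply: cvg_at_right_filter.
under eq_fun do rewrite -scalerN; exact: line_cvg.
Qed.

(** At a boundary point only the continuous extension [Du] is at hand. Its continuity carries the
    strict inequality of slopes to the inward segment, where the mean value theorem applies to
    [u (x - t *: v) + t * dotv xi v]. *)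
Lemma inward_decrease Om u Du x v xi :
  open Om -> closure Om x -> outward_unit_normal Om x v ->
  C1_closure Om u Du -> dotv xi v < dotv (Du x) v ->
  exists2 t, 0 < t & Om (x - t *: v) /\ u (x - t *: v) + t * dotv xi v < u x.
Proof.
move=> oOm clx [v1 vOm] [cu cDu uDu] xiv.
have vn := norm_le1_unit v1.
(* The definition of the normal is used with tolerance 1/2: the displacement [- t *: v] has scalar
   product [- t] with [v], and its sup norm is at most [t]. *)
have Om_near : \forall t \near 0^'+, Om (x - t *: v).
  have half0 : 0 < 2^-1 :> R by rewrite invr_gt0.
  near=> t.
  have t0 : 0 < t by near: t; exact: nbhs_right_gt.
  have [+ _] : (dotv (x - t *: v - x) v < - 2^-1 * `|x - t *: v - x| ->
      Om (x - t *: v)) /\ (2^-1 * `|x - t *: v - x| < dotv (x - t *: v - x) v ->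
      ~ Om (x - t *: v)).
    by near: t; exact: (@line_cvg_right x v _ (vOm _ half0)).
  apply; rewrite addrAC subrr sub0r dotvNl dotvZl v1 normrN normrZ gtr0_norm//.
  have : t * `|v| <= t * 1 by rewrite ler_wpM2l// ltW.
  lra.
have within_cvg (W : normedModType R) (f : V -> W) :
    {within closure Om, continuous f} ->
    f (x - t *: v) @[t --> 0^'+] --> f x.
  move=> /subspace_continuousP /(_ _ clx) cf P /cf Pf.
  have Pline : \forall t \near 0^'+, closure Om (x - t *: v) -> P (f (x - t *: v)).
    exact: (@line_cvg_right x v _ Pf).
  have clline : \forall t \near 0^'+, closure Om (x - t *: v).
    by apply: filterS Om_near => t; exact: subset_closure.
  by apply: filterS2 Pline clline => t; exact.
have slope_near : \forall t \near 0^'+, dotv xi v < dotv (Du (x - t *: v)) v.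
  apply: (cvgr_gt _ _ _ xiv).
  under eq_fun do rewrite dotvC; rewrite dotvC.
  apply: (continuous_cvg _ _ (within_cvg _ _ cDu)).
  by apply: differentiable_continuous; exact: differentiable_dotv.
have /nbhs_ballP[d /= d0 dP] : \forall t \near 0, 0 < t ->
    Om (x - t *: v) /\ dotv xi v < dotv (Du (x - t *: v)) v.
  exact: filterI Om_near slope_near.
have {}dP t : 0 < t -> t < d ->
    Om (x - t *: v) /\ dotv xi v < dotv (Du (x - t *: v)) v.
  by move=> t0 td; apply: dP => //; rewrite -ball_normE/= sub0r normrN gtr0_norm.
pose f t := u (x - t *: v) + t * dotv xi v.
pose t1 := d / 2.
have t10 : 0 < t1 by rewrite divr_gt0.
have t1d : t1 < d by rewrite /t1; lra.
pose df t := dotv xi v - dotv (Du (x - t *: v)) v.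
have f' t : 0 < t -> t <= t1 -> is_derive t 1 f (df t).
  move=> t0 tt1.
  have [Omt _] := dP _ t0 (le_lt_trans tt1 t1d).
  have [du gu] := uDu _ Omt.
  pose g t := u (x - t *: v).
  have quotE : (fun h => h^-1 *: ((g \o shift t) (h *: 1) - g t)) =
      (fun h => h^-1 *: ((u \o shift (x - t *: v)) (h *: (- v)) - u (x - t *: v))).
    apply/funext => h; rewrite /g /=; congr (_ *: (u _ - _)).
    by rewrite [h *: 1]mulr1 scalerDl opprD scalerN addrCA.
  have g' : is_derive t 1 g (- dotv (Du (x - t *: v)) v).
    apply: DeriveDef; first by rewrite /derivable quotE; exact: diff_derivable.
    by rewrite /derive quotE -gu -dotvNr -derive_grad.
  have lin' : is_derive t 1 (fun s : R => s * dotv xi v) (dotv xi v).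
    by apply: is_derive_eq; rewrite scaler0 add0r /GRing.scale/= mulr1.
  by rewrite /df addrC; apply: is_deriveD.
exists t1 => //; split; first by have [] := dP _ t10 t1d.
have f_derive t : t \in `]0, t1[ -> is_derive t 1 f (df t).
  by rewrite in_itv/= => /andP[t0 /ltW]; exact: f'.
have f_cont : {within `[0, t1], continuous f}.
  apply/continuous_within_itvP => //; split.
  + move=> t; rewrite in_itv/= => /andP[t0 /ltW tt1].
    by apply: differentiable_continuous; apply/derivable1_diffP; case: (f' _ t0 tt1).
  + rewrite /f scale0r mul0r subr0 addr0.
    have : f t @[t --> 0^'+] --> u x + 0 * dotv xi v.
      apply: cvgD; first exact: within_cvg.
      by apply: cvgMl; exact: cvg_at_right_filter.
    by rewrite mul0r addr0.
  + apply: cvg_at_left_filter; apply: differentiable_continuous.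
    by apply/derivable1_diffP; case: (f' _ t10 (lexx _)).
have [c] := MVT t10 f_derive f_cont; rewrite in_itv/= => /andP[c0 ct1].
have [_ cs] := dP _ c0 (lt_trans ct1 t1d).
rewrite /f /df scale0r mul0r subr0 addr0 subr0 => e.
have : df c * t1 < 0 by rewrite nmulr_rlt0 //; rewrite /df; lra.
rewrite /df -e; lra.
Unshelve. all: by end_near. Qed.

Lemma contact_slope_exists Om (nu : V -> V) u Du xi :
  bounded_domain Om ->
  (forall x, bdry Om x -> outward_unit_normal Om x (nu x)) ->
  C1_closure Om u Du -> (forall x, bdry Om x -> u x = 0) ->
  (forall x, bdry Om x -> dotv xi (nu x) < dotv (Du x) (nu x)) ->
  exists2 x, lower_contact Om u x & grad u x = xi.
Proof.
move=> [oOm _ Om0 bOm] nuP C1 u0 xilt.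
have [cu cDu uDu] := C1.
pose h y := u y - dotv xi y.
have hc : {within closure Om, continuous h}.
  have cxi : {within closure Om, continuous (dotv xi)}.
    apply: continuous_subspaceT => y.
    by apply: differentiable_continuous; exact: differentiable_dotv.
  by move=> y; apply: (continuousB (cu y) (cxi y)).
have [|z /set_mem clz zmin] := EVT_min_rV _ (closure_bounded_compact bOm) hc.
  by have [y Omy] := Om0; exists y; exact: subset_closure.
have {}zmin y : closure Om y -> h z <= h y by move=> /mem_set/zmin.
have [Omz|nOmz] := pselect (Om z); last first.
  have bz : bdry Om z by split => //; move/interior_subset.
  have [t t0 [Omt]] := inward_decrease oOm clz (nuP _ bz) C1 (xilt _ bz).
  have := zmin _ (subset_closure Omt).
  rewrite /h dotvBr dotvZr; lra.
have gz : grad u z = xi.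
  apply/rowP => i; rewrite mxE.
  apply: derive_of_min; first by apply: diff_derivable; have [] := uDu _ Omz.
  have Omh : \forall k \near 0, Om (z + k *: delta_mx 0 i).
    exact: (@line_cvg z (delta_mx 0 i) _ (open_nbhs_nbhs (conj oOm Omz))).
  near=> k.
  have Omk : Om (z + k *: delta_mx 0 i) by near: k.
  have := zmin _ (subset_closure Omk).
  rewrite /h dotvDr dotvZr dotv_delta; lra.
exists z => //; split => // y cly.
have := zmin _ cly; rewrite /h gz dotvBr; lra.
Unshelve. all: by end_near. Qed.

End ContactSlope.

(** * Measure of the gradient image *)

Section MeasureEstimate.
Context {R : realType} {n : nat}.
Local Notation V := 'rV[R]_n.+1.
Local Notation outer := (lebesgue_outer : {outer_measure set V -> \bar R}).
Local Notation U := (caratheodory_type outer).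
Implicit Types (Om : set V) (u F : V -> R).

Lemma continuous_grad Om u Du : open Om -> C1_closure Om u Du ->
  forall x, Om x -> {for x, continuous (grad u)}.
Proof.
move=> oOm [_ cDu uDu] x Omx.
have OmN : nbhs x Om by exact: open_nbhs_nbhs.
have Du_cvg : Du y @[y --> x] --> Du x.
  move=> P DuP; have := (subspace_continuousP _ _).1 cDu x (subset_closure Omx) P DuP.
  move=> wP; apply: filterS2 OmN wP => y Omy; apply; exact: subset_closure.
suff : grad u y @[y --> x] --> grad u x by [].
have eqDu : \forall y \near x, Du y = grad u y.
  by apply: filterS OmN => y Omy; rewrite (uDu _ Omy).2.
by rewrite (uDu _ Omx).2; exact: cvg_trans (near_eq_cvg eqDu) Du_cvg.
Qed.

Lemma continuous_dotv_fun (W : topologicalType) (f g : W -> V) (x : W) :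
  {for x, continuous f} -> {for x, continuous g} ->
  {for x, continuous (fun y => dotv (f y) (g y))}.
Proof.
move=> cf cg.
have coord (h : W -> V) i : {for x, continuous h} ->
    {for x, continuous (fun y => h y 0 i)}.
  move=> ch; apply: (@continuous_comp _ _ _ h (fun z : V => z 0 i) x ch).
  exact: coord_continuous.
rewrite (_ : (fun y => _) = \sum_(i < n.+1) (fun y => f y 0 i * g y 0 i)).
  elim/big_ind : _ => [|h k ch ck|i _].
  - exact: cst_continuous.
  - exact: continuousD.
  - by apply: continuousM; exact: coord.
by apply/funext => y; rewrite fct_sumE.
Qed.

(** A point of [Om] fails to be a contact point because of a single [y], and for this fixed [y] the
    strict inequality persists nearby. So the contact set is relatively closed in [Om]. *)
Lemma measurable_lower_contact Om u : open Om ->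
  (forall x, Om x -> {for x, continuous u}) ->
  (forall x, Om x -> {for x, continuous (grad u)}) ->
  measurable (lower_contact Om u : set U).
Proof.
move=> oOm cu cg.
have -> : lower_contact Om u = Om `\` (Om `\` lower_contact Om u).
  by rewrite setDD; apply/seteqP; split => [x [Omx h]|x []//]; split.
apply: measurableD; first exact: measurable_open.
apply: measurable_open; rewrite openE => x [Omx nGx].
have [y [cly ylt]] : exists y, closure Om y /\
    u y < u x + dotv (grad u x) (y - x).
  apply: contrapT => h; apply: nGx; split => // y cly.
  by rewrite leNgt; apply/negP => ylt; apply: h; exists y.
have c : {for x, continuous (fun z => u z + dotv (grad u z) (y - z))}.
  apply: continuousD; first exact: cu.
  apply: continuous_dotv_fun; first exact: cg.
  by apply: continuousB => //; exact: cst_continuous.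
have near1 : \forall z \near x, u y < u z + dotv (grad u z) (y - z).
  exact: (cvgr_gt _ c _ ylt).
have OmN : nbhs x Om by exact: open_nbhs_nbhs.
apply: filterS2 OmN near1 => z Omz zlt; split => // -[_ /(_ _ cly)].
by rewrite leNgt zlt.
Qed.

Lemma expr_add_le (a b : R) k : 0 <= a -> 0 <= b ->
  (a + b) ^+ k <= 2 ^+ k * (a ^+ k + b ^+ k).
Proof.
move=> a0 b0.
have ak := exprn_ge0 k a0; have bk := exprn_ge0 k b0.
have [ab|ba] := leP a b.
  apply: (@le_trans _ _ ((2 * b) ^+ k)).
    by rewrite lerXn2r ?nnegrE ?addr_ge0 ?mulr_ge0//; lra.
  by rewrite exprMn ler_wpM2l ?exprn_ge0// lerDr.
apply: (@le_trans _ _ ((2 * a) ^+ k)).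
  by rewrite lerXn2r ?nnegrE ?addr_ge0 ?mulr_ge0//; lra.
by rewrite exprMn ler_wpM2l ?exprn_ge0// lerDl.
Qed.

(** On a piece where [F] stays within [eps] of a constant, the gradient has one Lipschitz constant,
    and the bound for the image of the piece is the integral of a constant below the integrand.
    Summing over disjoint pieces gives the integral. *)
Lemma outer_grad_contact_le Om (vt vT lam lam' eps : R) u F :
  0 < vt -> vt <= vT -> open Om -> 0 <= lam' -> lam <= lam' ->
  (forall x, Om x -> {for x, continuous F}) ->
  (forall x, Om x -> {for x, continuous (grad u)}) ->
  (forall x, 0 <= F x) ->
  Mminus_class Om vt vT (fun x => lam * F x) u -> 0 < eps ->
  (outer (grad u @` lower_contact Om u) <=
   \int[lebesgue_rV]_(x in (lower_contact Om u : set U))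
     ((16 * (slope_constant (n := n) vt *
        (lam' * F x + (2 * lam' + 1) * eps))) ^+ n.+1)%:E)%E.
Proof.
move=> vt0 vtT oOm lam'0 lamle cF cg F0 uM eps0.
have cu := uM.1.
have sc0 : 0 < slope_constant (n := n) vt :> R by rewrite divr_gt0// mulr_gt0.
set G := lower_contact Om u.
pose H x := (16 * (slope_constant (n := n) vt *
  (lam' * F x + (2 * lam' + 1) * eps))) ^+ n.+1.
rewrite -/(H _).
have mG : measurable (G : set U) by exact: measurable_lower_contact.
pose T := ('rV[rat]_n.+1 * 'rV[rat]_n.+1)%type.
(* The control of [F] reaches a distance [d] beyond the box, since the barrier at a contact point
   involves a whole neighbourhood, which may leave the piece. *)
pose good (q : T) := exists c d : R, [/\ 0 <= c, 0 < d & forall x y : V,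
  open_box (rat_box q) x -> `|y - x| < d ->
  Om y /\ c <= F y + eps /\ F y <= c + eps].
(* Codes of no box, or of a box that is not good, give the empty set, for which the constants 0 and
   1 serve vacuously in [Egood]. *)
pose E (k : nat) : set V := if unpickle k is Some q then
  if `[< good q >] then open_box (rat_box q) else set0 else set0.
have Egood k : exists c d : R, [/\ 0 <= c, 0 < d & forall x y : V,
    E k x -> `|y - x| < d -> Om y /\ c <= F y + eps /\ F y <= c + eps].
  rewrite /E; case: unpickle => [q|].
    case: asboolP => [[c [d [c0 d0 h]]]|_]; first by exists c, d; split.
    by exists 0, 1; split.
  by exists 0, 1; split.
have mE k : measurable (E k : set U).
  rewrite /E; case: unpickle => [q|]; last exact: measurable0.
  by case: ifP => _; [exact: measurable_open_box|exact: measurable0].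
have OmE : G `<=` \bigcup_k E k.
  move=> x [Omx _].
  have Fnear : \forall y \near x, Om y /\ (F x <= F y + eps /\ F y <= F x + eps).
    have OmN : nbhs x Om by exact: open_nbhs_nbhs.
    have h1 : \forall y \near x, F x - eps < F y.
      by apply: (cvgr_gt _ (cF _ Omx)); lra.
    have h2 : \forall y \near x, F y < F x + eps.
      by apply: (cvgr_lt _ (cF _ Omx)); lra.
    apply: filterS3 OmN h1 h2 => y ? ? ?; split => //; split; lra.
  have /nbhs_ballP[d /= d0 dP] := Fnear.
  have d20 : 0 < d / 2 by rewrite divr_gt0.
  have [q [qx qd]] := rat_box_nbhs (nbhsx_ballx x _ d20).
  exists (pickle q) => //; rewrite /E pickleK ifT//; apply/asboolP.
  exists (F x), (d / 2); split => // y z /qd.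
  rewrite -ball_normE/= => xy zy; apply: dP; rewrite -ball_normE/=.
  rewrite -(subrKA y) (le_lt_trans (ler_normD _ _))//.
  by rewrite [`|y - z|]distrC; lra.
pose A k : set V := G `&` seqDU E k.
have mA k : measurable (A k : set U).
  by apply: measurableI => //; exact: seqDU_measurable.
have GA : G = \bigcup_k A k.
  by rewrite -setI_bigcupr -seqDU_bigcup_eq; apply/esym/setIidl.
have mH : measurable_fun (G : set U) (EFin \o H).
  apply/measurable_EFinP; apply: measurable_funX.
  apply: measurable_funM; first exact: measurable_cst.
  apply: measurable_funM; first exact: measurable_cst.
  apply: measurable_funD; last exact: measurable_cst.
  apply: measurable_funM; first exact: measurable_cst.
  apply: (@measurable_funS _ _ _ _ (Om : set U)); first exact: measurable_open.
    by move=> x [].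
  exact: measurable_fun_open.
have H0 x : 0 <= H x.
  rewrite /H exprn_ge0// mulr_ge0// mulr_ge0 ?(ltW sc0)// addr_ge0//.
    by rewrite mulr_ge0.
  by rewrite mulr_ge0 ?(ltW eps0)// addr_ge0// mulr_ge0.
have piece k : (outer (grad u @` A k) <=
    \int[lebesgue_rV]_(x in (A k : set U)) (H x)%:E)%E.
  have [c [d [c0 d0 cP]]] := Egood k.
  (* The last [eps] makes [K] positive even if [lam' = 0]. As [c <= F x + eps] on the piece, [K] is
     at most [lam' * F x + (2 * lam' + 1) * eps]. *)
  pose K := lam' * (c + eps) + eps.
  have K0 : 0 < K by rewrite /K ltr_wpDl// mulr_ge0// addr_ge0// ltW.
  have AE x : A k x -> E k x by move=> [_]; exact: subset_seqDU.
  have AG : A k `<=` lower_contact Om u by move=> x [].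
  have bnd (x y : V) : A k x -> `|y - x| < d -> Om y /\ lam * F y <= K.
    move=> /AE Ex yx; have [Omy [_ Fy]] := cP _ _ Ex yx; split => //.
    have h1 : lam * F y <= lam' * F y by rewrite ler_wpM2r.
    have h2 : lam' * F y <= lam' * (c + eps) by rewrite ler_wpM2l.
    rewrite /K; lra.
  have [e e0 lip] := grad_lipschitz_contact vt0 vtT uM AG d0 K0 bnd.
  have L0 : 0 < slope_constant (n := n) vt * K by rewrite mulr_gt0.
  apply: (le_trans (lebesgue_outer_image_le L0 e0 lip)).
  have <- : (\int[lebesgue_rV]_(x in (A k : set U))
      (cst ((16 * (slope_constant (n := n) vt * K)) ^+ n.+1)%:E) x =
      ((16 * (slope_constant (n := n) vt * K)) ^+ n.+1)%:E * outer (A k))%E.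
    by rewrite integral_cst.
  apply: ge0_le_integral => //.
  - by move=> x _; rewrite lee_fin exprn_ge0// mulr_ge0// ltW.
  - by apply: measurable_funS mH => // x [].
  - move=> x Ax; rewrite lee_fin /H.
    have KH : K <= lam' * F x + (2 * lam' + 1) * eps.
      have xx : `|x - x| < d by rewrite subrr normr0.
      have [_ [cF' _]] := cP _ x (AE _ Ax) xx.
      have : lam' * c <= lam' * (F x + eps) by rewrite ler_wpM2l.
      rewrite /K; lra.
    have slK : slope_constant (n := n) vt * K <=
        slope_constant (n := n) vt * (lam' * F x + (2 * lam' + 1) * eps).
      by rewrite ler_pM2l.
    have L0' := le_trans (ltW L0) slK.
    apply: lerXn2r; rewrite ?nnegrE; last by rewrite ler_pM2l.
      by apply: mulr_ge0 => //; exact: ltW.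
    exact: mulr_ge0.
have -> : (\int[lebesgue_rV]_(x in (G : set U)) (H x)%:E =
    \sum_(k <oo) \int[lebesgue_rV]_(x in (A k : set U)) (H x)%:E)%E.
  rewrite GA; apply: ge0_integral_bigcup => //.
  - by rewrite -GA.
  - by move=> x _; rewrite lee_fin.
  - by apply: trivIset_setIl; exact: trivIset_seqDU.
apply: (@le_trans _ _ (\sum_(k <oo) outer (grad u @` A k))%E).
  rewrite [in leLHS]GA image_bigcup; exact: outer_measure_sigma_subadditive.
by apply: lee_nneseries => [k _ _|k _]; [exact: outer_measure_ge0|exact: piece].
Qed.

End MeasureEstimate.

(** * The estimate in terms of the L^N norm, and the theorem *)

Lemma continuous_normr_powR {R : realType} (p : R) : 1 <= p ->
  continuous (fun t : R => `|t| `^ p).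
Proof.
move=> p1 t; have p0 : 0 < p by exact: lt_le_trans p1.
(* At 0 the assumption [1 <= p] gives [|s|^p <= |s|] for [|s| <= 1]; elsewhere the power is
   differentiable. *)
have [->|t0] := eqVneq t 0.
  apply/cvgrPdist_lt => e e0; rewrite normr0 powR0 ?gt_eqF//.
  near=> s; rewrite sub0r normrN ger0_norm ?powR_ge0//.
  apply: (@le_lt_trans _ _ `|s|).
    have [->|s0] := eqVneq s 0; first by rewrite normr0 powR0// gt_eqF.
    apply: ge1r_powR => //; rewrite normr_gt0 s0/= ltW//.
  by near: s; exact: (@nbhs0_lt R R _ e0).
apply: (@continuous_comp R R R (fun t => `|t|) (fun t => t `^ p) t).
  exact: norm_continuous.
apply: differentiable_continuous; apply/derivable1_diffP.
by apply: derivable_powR; rewrite in_itv/= andbT normr_gt0.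
Unshelve. all: by end_near. Qed.

Section Conclusion.
Context {R : realType} {n : nat}.
Local Notation V := 'rV[R]_n.+1.
Local Notation outer := (lebesgue_outer : {outer_measure set V -> \bar R}).
Local Notation U := (caratheodory_type outer).

(** Finite measure is what lets the error, a multiple of [eps] times the measure of the contact set,
    tend to 0. *)
Lemma lebesgue_outer_bounded_fin (A : set V) : bounded_set A ->
  exists2 S : R, 0 <= S & (outer A <= S%:E)%E.
Proof.
move=> [M [Mreal AM]].
(* Boundedness yields bounds strictly above [M], such as [M + 1], and the box is open; hence
   [M + 2]. *)
pose ab : V * V := (const_mx (- (M + 2)), const_mx (M + 2)).
exists (box_volume ab); first exact: box_volume_ge0.
apply: (le_trans _ (lebesgue_outer_open_box ab)).
apply: le_outer_measure => x Ax i; rewrite !mxE.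
have xM : `|x| <= M + 1 by apply: AM => //; lra.
have := le_trans (coord_norm_le x i) xM; rewrite ler_norml => /andP[? ?].
by apply/andP; split; lra.
Qed.

Lemma Lnorm_on_expn (A : set V) (f : V -> R) k : (forall x, 0 <= f x) ->
  (Lnorm_on k.+1%:R A f `^ k.+1%:R = \int[lebesgue_rV]_(x in (A : set U)) (f x ^+ k.+1)%:E)%E.
Proof.
move=> f0; rewrite /Lnorm_on poweR_Lnorm// [RHS]integral_mkcond.
apply: eq_integral => x _; rewrite /= !patchE; case: ifPn => _ /=.
  by rewrite ger0_norm// powR_mulrn.
(* Outside [A] the restriction takes the default value [point], which is 0 in [R], so nothing is
   added to the integral. *)
have point0 : point = 0 :> R by [].
by rewrite point0 normr0 powR0.
Qed.

Lemma cube_volume_le_integral (Om : set V) (vt vT lam lam' h : R) (u F : V -> R) :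
  0 < vt -> vt <= vT -> open Om -> bounded_set Om -> 0 <= lam' -> lam <= lam' ->
  (forall x, Om x -> {for x, continuous F}) ->
  (forall x, Om x -> {for x, continuous (grad u)}) ->
  (forall x, 0 <= F x) ->
  Mminus_class Om vt vT (fun x => lam * F x) u -> 0 < h ->
  cube h `<=` grad u @` lower_contact Om u ->
  (((2 * h) ^+ n.+1)%:E <= ((32 * slope_constant (n := n) vt * lam') ^+ n.+1)%:E *
   \int[lebesgue_rV]_(x in (lower_contact Om u : set U)) (F x ^+ n.+1)%:E)%E.
Proof.
move=> vt0 vtT oOm bOm lam'0 lamle cF cg F0 uM h0 cubeG.
have sc0 : 0 < slope_constant (n := n) vt :> R by rewrite divr_gt0// mulr_gt0.
set sc := slope_constant vt in sc0 *; set G := lower_contact Om u.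
have mG : measurable (G : set U) by apply: measurable_lower_contact => //; exact: uM.1.
have [S S0 GS] : exists2 S : R, 0 <= S & (outer G <= S%:E)%E.
  have [S S0 OmS] := lebesgue_outer_bounded_fin bOm; exists S => //.
  by apply: le_trans OmS; apply: le_outer_measure => x [].
pose k := 2 * lam' + 1.
have k0 : 0 < k by rewrite ltr_wpDl// mulr_ge0.
pose M := (32 * sc) ^+ n.+1.
have M0 : 0 < M by rewrite exprn_gt0// mulr_gt0.
have mF1 : measurable_fun (G : set U) (F : U -> R).
  apply: (@measurable_funS _ _ _ _ (Om : set U)); first exact: measurable_open.
    by move=> x [].
  exact: measurable_fun_open.
have mF : measurable_fun (G : set U) (fun x : U => (F x ^+ n.+1)%:E).
  by apply/measurable_EFinP; exact: measurable_funX.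
have bound eps : 0 < eps -> eps <= 1 -> (((2 * h) ^+ n.+1)%:E <=
    (M * lam' ^+ n.+1)%:E * \int[lebesgue_rV]_(x in (G : set U)) (F x ^+ n.+1)%:E
    + (M * (k ^+ n.+1 * eps) * S)%:E)%E.
  move=> eps0 eps1.
  apply: (le_trans (lebesgue_outer_cube_ge h0)).
  apply: (le_trans (le_outer_measure outer _ _ cubeG)).
  apply: (le_trans (outer_grad_contact_le vt0 vtT oOm lam'0 lamle cF cg F0 uM eps0)).
  rewrite -/G -/sc -/k.
  apply: (@le_trans _ _ (\int[lebesgue_rV]_(x in (G : set U))
    ((M * lam' ^+ n.+1)%:E * (F x ^+ n.+1)%:E + cst (M * (k ^+ n.+1 * eps))%:E x))%E).
    apply: ge0_le_integral => //.
    - move=> x _; rewrite lee_fin exprn_ge0// mulr_ge0// mulr_ge0 ?(ltW sc0)//.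
      by apply: addr_ge0; apply: mulr_ge0 => //; exact: ltW.
    - apply/measurable_EFinP; apply: measurable_funX.
      apply: measurable_funM; first exact: measurable_cst.
      apply: measurable_funM; first exact: measurable_cst.
      apply: measurable_funD; last exact: measurable_cst.
      by apply: measurable_funM; first exact: measurable_cst.
    - apply: emeasurable_funD; last exact: measurable_cst.
      exact: measurable_funeM.
    - move=> x _; rewrite -EFinM -EFinD lee_fin mulrA exprMn.
      have kF : 0 <= lam' * F x by rewrite mulr_ge0.
      have keps : 0 <= k * eps by rewrite mulr_ge0// ltW.
      have sc16 : 0 <= (16 * sc) ^+ n.+1 by rewrite exprn_ge0// mulr_ge0// ltW.
      apply: (le_trans (ler_wpM2l sc16 (expr_add_le n.+1 kF keps))).
      have epsN : eps ^+ n.+1 <= eps by rewrite exprS ger_pMr// exprn_ile1// ltW.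
      have -> : M = (16 * sc) ^+ n.+1 * 2 ^+ n.+1.
        by rewrite -exprMn /M; congr (_ ^+ _); ring.
      rewrite [leLHS]mulrA (exprMn _ lam') (exprMn _ k) mulrDr.
      rewrite [X in X + _ <= _]mulrA lerD2l.
      apply: ler_wpM2l; first exact: mulr_ge0 sc16 (exprn_ge0 _ (ler0n _ 2)).
      by apply: ler_wpM2l => //; apply: exprn_ge0; exact: ltW.
  have Mlam0 : 0 <= M * lam' ^+ n.+1.
    by apply: mulr_ge0; [exact: ltW|exact: exprn_ge0].
  have Mk0 : 0 <= M * (k ^+ n.+1 * eps).
    apply: mulr_ge0; first exact: ltW.
    by apply: mulr_ge0; [apply: exprn_ge0; exact: ltW|exact: ltW].
  have FN0 x : (0 <= (F x ^+ n.+1)%:E)%E by rewrite lee_fin exprn_ge0.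
  rewrite ge0_integralD//; last 2 first.
  - by move=> x _; rewrite mule_ge0.
  - exact: measurable_funeM.
  rewrite ge0_integralZl_EFin// integral_cst//; apply: leeD => //.
  by rewrite [leRHS]EFinM; apply: lee_wpmul2l.
rewrite (exprMn _ (32 * sc)) -/M.
apply/lee_addgt0Pr => e e0.
pose q := M * k ^+ n.+1 * S.
have q0 : 0 <= q.
  by apply: mulr_ge0 => //; apply: mulr_ge0; [|apply: exprn_ge0]; exact: ltW.
(* The bound by 1 is there because [bound] replaces [eps ^+ n.+1] by [eps]; the other term makes the
   error [q * eps] at most [e], also when [q = 0]. *)
pose eps := Num.min 1 (e / (q + 1)).
have eps0 : 0 < eps by rewrite lt_min ltr01 divr_gt0// ltr_wpDl.
apply: (le_trans (bound eps eps0 _)); first by rewrite ge_min lexx.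
apply: leeD => //; rewrite lee_fin.
have -> : M * (k ^+ n.+1 * eps) * S = q * eps by rewrite /q; ring.
have : eps <= e / (q + 1) by rewrite ge_min lexx orbT.
rewrite ler_pdivlMr ?ltr_wpDl// => epsq.
by apply: le_trans epsq; rewrite mulrC ler_pM2l// lerDl.
Qed.

End Conclusion.

Theorem corollary4p9 (R : realType) (n : nat) (vt vT : R)
    (vt_gt0 : 0 < vt) (le_vt_vT : vt <= vT) :
  exists2 C : R, 0 < C &
  forall (Om : set 'rV[R]_n.+1) (nu : 'rV[R]_n.+1 -> 'rV[R]_n.+1)
         (p lam : R) (u : 'rV[R]_n.+1 -> R)
         (Du : 'rV[R]_n.+1 -> 'rV[R]_n.+1),
    bounded_domain Om ->
    (forall x, bdry Om x -> outward_unit_normal Om x (nu x)) ->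
    1 <= p ->
    Mminus_class Om vt vT (fun x => lam * `|u x| `^ p) u ->
    C1_closure Om u Du ->
    (forall x, bdry Om x -> u x = 0) ->
    (* that is, du/dnu = |du/dnu| *)
    (forall x, bdry Om x -> 0 <= dotv (Du x) (nu x)) ->
    0 < inf [set `|dotv (Du x) (nu x)| | x in bdry Om] ->
    ((inf [set `|dotv (Du x) (nu x)| | x in bdry Om])%:E /
       (C%:E * Lnorm_on n.+1%:R (Om `&` lower_contact Om u)
                        (fun x => `|u x| `^ p)%R)
     <= lam%:E)%E.
Proof.
have N0 : 0 < n.+1%:R :> R by [].
pose sc : R := slope_constant (n := n) vt.
have sc0 : 0 < sc by rewrite divr_gt0// mulr_gt0.
(* Here 32 is the 16 of the image estimate times the 2 of [expr_add_le], [sc] is the Lipschitz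
   factor, and N comes from the side [m / N] of the cube. *)
exists (32 * sc * n.+1%:R); first by rewrite mulr_gt0// mulr_gt0.
move=> Om nu p lam u Du bOm nuP p1 uM C1 u0 Dnu0.
set m := inf _ => m0.
pose F x := `|u x| `^ p.
have F0 x : 0 <= F x by exact: powR_ge0.
have [oOm _ _ bdOm] := bOm.
have cF x : Om x -> {for x, continuous F}.
  move=> Omx; apply: (@continuous_comp _ _ _ u (fun t => `|t| `^ p)).
    exact: uM.1.
  exact: continuous_normr_powR.
have cg := continuous_grad oOm C1.
have m_le x : bdry Om x -> m <= dotv (Du x) (nu x).
  move=> bx; rewrite -[leRHS]ger0_norm ?Dnu0//.
  apply: ge_inf; last by exists x.
  by exists 0 => _ [y _ <-].
pose h := m / (2 * n.+1%:R).
have h0 : 0 < h by rewrite divr_gt0// mulr_gt0.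
have cubeG : cube h `<=` grad u @` lower_contact Om u.
  move=> xi xih.
  have [x Gx <-] : exists2 x, lower_contact Om u x & grad u x = xi.
    apply: (contact_slope_exists bOm nuP C1 u0) => x bx.
    apply: lt_le_trans (m_le _ bx).
    apply: (le_lt_trans (ler_norm _)).
    have xin i : `|xi 0 i| <= h by rewrite ler_norml; exact: xih.
    apply: (le_lt_trans (dotv_le_norm _ (ltW h0) xin)).
    apply: (@le_lt_trans _ _ (n.+1%:R * (h * 1))).
      by rewrite ler_pM2l// ler_pM2l// norm_le1_unit// (nuP _ bx).1.
    have -> : n.+1%:R * (h * 1) = m / 2 by rewrite /h; field; rewrite gt_eqF.
    lra.
  by exists x.
have -> : Om `&` lower_contact Om u = lower_contact Om u.
  by apply/setIidr => x [].
set L := Lnorm_on _ _ _.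
have L0 : (0 <= L)%E by exact: Lnorm_ge0.
have LI := Lnorm_on_expn (lower_contact Om u) n F0.
have key lam' : 0 <= lam' -> lam <= lam' -> (((m / n.+1%:R) ^+ n.+1)%:E <=
    ((32 * sc * lam') ^+ n.+1)%:E * (L `^ n.+1%:R))%E.
  move=> lam'0 lamle; rewrite /L LI.
  have -> : m / n.+1%:R = 2 * h by rewrite /h; field; rewrite gt_eqF.
  exact: (cube_volume_le_integral vt_gt0 le_vt_vT oOm bdOm lam'0 lamle cF cg F0 uM h0).
have mN0 : 0 < (m / n.+1%:R) ^+ n.+1 by rewrite exprn_gt0// divr_gt0.
(* If [lam <= 0], then [lam' = 0] is admissible in [key], and the cube would have volume 0; an
   infinite norm does no harm, as 0 times +oo is 0. *)
have lam0 : 0 < lam.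
  rewrite ltNge; apply/negP => lam_le0.
  have := key 0 (lexx _) lam_le0.
  by rewrite mulr0 expr0n/= mul0e lee_fin leNgt mN0.
have {key} := key lam (ltW lam0) (lexx _).
(* If the norm is infinite, the quotient is 0 and the claim is the positivity of [lam]. *)
move: LI => _; case: L L0 => [l l0||//]; last first.
  move=> _ _; have C0 : 0 < 32 * sc * n.+1%:R by rewrite mulr_gt0// mulr_gt0.
  by rewrite gt0_muley ?lte_fin// invey mule0 lee_fin ltW.
rewrite lee_fin in l0.
rewrite poweR_EFin powR_mulrn// -EFinM lee_fin -exprMn.
have scl0 : 0 <= 32 * sc * lam by apply: mulr_ge0; [apply: mulr_ge0|]; exact: ltW.
rewrite ler_pXn2r ?nnegrE//; [|by rewrite divr_ge0// ltW|exact: mulr_ge0].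
move=> ml.
(* The norm must be nonzero for the extended quotient to be the real one; a zero norm would again
   give the cube side 0. *)
have l_gt0 : 0 < l.
  rewrite lt_neqAle l0 andbT; apply/eqP => l00.
  by move: ml; rewrite -l00 mulr0 leNgt divr_gt0.
have den0 : 0 < 32 * sc * n.+1%:R * l.
  by apply: mulr_gt0 => //; apply: mulr_gt0 => //; exact: mulr_gt0.
rewrite -EFinM inver gt_eqF//= -EFinM lee_fin ler_pdivrMr//.
move: ml; rewrite ler_pdivrMr// => /le_trans; apply.
by rewrite le_eqVlt; apply/orP; left; apply/eqP; ring.
Qed.
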